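(* Let $n\ge1$ and let $\mathbf P=(\Delta_{[i,j]})_{1\le i\le j\le n}$ with variables $\mathbf x=(x_{ij})_{1\le i\le j\le n}$. When $\langle\mathbf x,\mathbf 1\rangle=\sum_{1\le i\le j\le n}x_{ij}=0$, the hyperplane dual mixed volume of the associahedron is $$\tilde m_{\mathbf P}(\mathbf x)|_{\langle\mathbf x,\mathbf 1\rangle=0}=(-1)^{n-1}\sum_{B\in\mathcal{PB}(n)}\ \prod_{e\in B}\frac{1}{\sum_{i\le j;\ i,j\in L_{B,e}}x_{ij}},$$ where the product is over the edges $e$ of $B$.
   Context: $\Delta_{[i,j]}=\mathrm{conv}(\mathbf e_i,\mathbf e_{i+1},\dots,\mathbf e_j)\subset\mathbb{R}^n$; the associahedron is $\mathbf x\mathbf P=\sum_{1\le i\le j\le n}x_{ij}\Delta_{[i,j]}$. $\mathcal{PB}(n)$ is the set of plane binary trees with $n$ nodes: rooted trees in which each node has at most one left child and at most one right child (an only child is specified to be left or right). The nodes of $B\in\mathcal{PB}(n)$ are labelled $1,\dots,n$ in the unique way such that for each node $i$ all nodes in its left branch have labels $<i$ and all nodes in its right branch have labels $>i$. For an edge $e$ of $B$, deleting $e$ splits $[n]$ into two connected components $L_{B,e}\sqcup U_{B,e}$ with $U_{B,e}$ containing the root. Hyperplane dual mixed volume: let $\mathbf P=(P_1,\dots,P_r)$ be polytopes in $\{\mathbf y\in\mathbb{R}^n:\sum y_i=1\}$ whose Minkowski sum $P$ has dimension $n-1$. Let $\mathrm{cone}(P)=\{t\mathbf y:\mathbf y\in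 P,t\ge0\}$ and $\mathrm{cone}(P)^*=\{\mathbf v:\langle\mathbf v,\mathbf y\rangle\ge0\ \forall\mathbf y\in\mathrm{cone}(P)\}$. With $h_{P_i}(\mathbf v)=-\min_{\mathbf y\in P_i}\langle\mathbf v,\mathbf y\rangle$ and $\mathcal T$ a triangulation of the boundary of $\mathrm{cone}(P)^*$ into $(n-1)$-dimensional simplicial cones, $$\tilde m_{\mathbf P}(\mathbf x,\mathbf z)=\sum_{F=\mathrm{span}_{\ge0}(\mathbf v_1,\dots,\mathbf v_{n-1})\in\mathcal T}\frac{|\det(\mathbf v_1,\dots,\mathbf v_{n-1},\mathbf 1)|}{\prod_{k=1}^{n-1}\bigl(\sum_{i}x_ih_{P_i}(\mathbf v_k)+\langle\mathbf v_k,\mathbf z\rangle\bigr)},\qquad\mathbf 1=(1,\dots,1),$$ (independent of $\mathcal T$). $\tilde m_{\mathbf P}(\mathbf x)$ means $\tilde m_{\mathbf P}(\mathbf x,\mathbf 0)$, and $|_{\langle\mathbf x,\mathbf 1\rangle=0}$ denotes restriction of this rational function to the hyperplane where the sum of all variables $\mathbf x$ is zero. *)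

(* Defs.v *)
From HB Require Import structures.
From mathcomp Require Import all_boot all_order all_algebra.
From mathcomp Require Import all_classical all_reals.
From mathcomp Require Import topology normedtype.

Set Implicit Arguments.
Unset Strict Implicit.
Unset Printing Implicit Defensive.

Import Order.TTheory GRing.Theory Num.Theory.
Import numFieldNormedType.Exports.

Local Open Scope classical_set_scope.
Local Open Scope ring_scope.

(* The ambient space R^n with n >= 1 is 'rV[R]_n.+1, so [n.+1] below plays the
   role of n on paper, and [n] that of n - 1. Coordinates and tree labels
   1, ..., n on paper are the ordinals 0, ..., n of 'I_n.+1. *)

Section ConvexGeometry.
Context {R : realType} {n : nat}.
Implicit Types (P C : set 'rV[R]_n.+1) (v y : 'rV[R]_n.+1).

Definition dotv v y : R := \sum_(k < n.+1) v 0 k * y 0 k.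

Definition conv_hull (I : finType) (A : {set I}) (p : I -> 'rV[R]_n.+1) :
    set 'rV[R]_n.+1 :=
  [set y | exists2 a : I -> R,
     (forall k, 0 <= a k) /\ \sum_(k in A) a k = 1 &
     y = \sum_(k in A) a k *: p k].

Definition minkowski_sum (I : finType) (P : I -> set 'rV[R]_n.+1) :
    set 'rV[R]_n.+1 :=
  [set y | exists2 f : I -> 'rV[R]_n.+1,
     forall i, P i (f i) & y = \sum_i f i].

Definition cone_over P : set 'rV[R]_n.+1 :=
  [set y | exists t p, [/\ 0 <= t, P p & y = t *: p]].

Definition dual_cone C : set 'rV[R]_n.+1 :=
  [set v | forall y, C y -> 0 <= dotv v y].

Definition boundary (C : set 'rV[R]_n.+1) : set 'rV[R]_n.+1 :=
  closure C `\` C°.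

(* The infimum is a minimum when P is a (nonempty) polytope. *)
Definition support_fun P v : R := - inf [set dotv v y | y in P].

(* A cone is given by n generators, the rows of V. Its faces, when the
   generators are linearly independent, are the cones spanned by subsets of
   these generators. *)
Definition cone_face (V : 'M[R]_(n, n.+1)) (S : {set 'I_n}) :
    set 'rV[R]_n.+1 :=
  [set v | exists2 a : 'I_n -> R,
     forall k, 0 <= a k & v = \sum_(k in S) a k *: row k V].

Definition cone_span (V : 'M[R]_(n, n.+1)) : set 'rV[R]_n.+1 :=
  cone_face V [set: 'I_n]%SET.

Definition simplicial_triangulation (X : set 'rV[R]_n.+1)
    (T : seq 'M[R]_(n, n.+1)) : Prop :=
  [/\ forall V, V \in T -> row_free V,
      uniq T /\ {in T &, injective cone_span},
      \bigcup_(V in [set` T]) cone_span V = X &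
      forall V W, V \in T -> W \in T ->
        exists S S', cone_span V `&` cone_span W = cone_face V S /\
                     cone_span V `&` cone_span W = cone_face W S'].

End ConvexGeometry.

Section HyperplaneDualMixedVolume.
Context {R : realType} {n : nat} {I : finType}.
Variable P : I -> set 'rV[R]_n.+1.
Implicit Types (T : seq 'M[R]_(n, n.+1)) (x : I -> R) (z v : 'rV[R]_n.+1).

Definition is_dmv_triangulation T : Prop :=
  simplicial_triangulation
    (boundary (dual_cone (cone_over (minkowski_sum P)))) T.

Definition dmv_form x z v : R :=
  \sum_i x i * support_fun (P i) v + dotv v z.

(* The value at (x, z) of the rational function defined by T; it is meaningful
   only where [dmv_regular] holds, as division by 0 returns 0. The vector
   (1, ..., 1) is put in the first row rather than the last column, which
   does not change the absolute value of the determinant. *)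
Definition hyp_dual_mixed_volume T x z : R :=
  \sum_(V <- T)
    `|\det (col_mx (const_mx 1 : 'rV[R]_n.+1) V : 'M[R]_n.+1)|
    / \prod_(k < n) dmv_form x z (row k V).

Definition dmv_regular T x z : Prop :=
  forall V, V \in T -> forall k, dmv_form x z (row k V) != 0.

End HyperplaneDualMixedVolume.

Definition interval_idx n := {p : 'I_n * 'I_n | (p.1 <= p.2)%N}.

Definition Delta {R : realType} {n} (p : interval_idx n.+1) : set 'rV[R]_n.+1 :=
  conv_hull [set k : 'I_n.+1 | ((val p).1 <= k <= (val p).2)%N]%SET
            (fun k => delta_mx 0 k).

(* [Leaf] is an absent child. *)
Inductive pbtree := Leaf | Node of pbtree & pbtree.

Fixpoint pbtree_encode B : GenTree.tree unit :=
  if B is Node l r then GenTree.Node 0 [:: pbtree_encode l; pbtree_encode r]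
  else GenTree.Leaf tt.

Fixpoint pbtree_decode (t : GenTree.tree unit) : pbtree :=
  if t is GenTree.Node _ [:: l; r] then Node (pbtree_decode l) (pbtree_decode r)
  else Leaf.

Lemma pbtree_encodeK : cancel pbtree_encode pbtree_decode.
Proof. by elim=> //= l -> r ->. Qed.

HB.instance Definition _ := Countable.copy pbtree (can_type pbtree_encodeK).

Fixpoint nnodes B : nat :=
  if B is Node l r then (nnodes l + nnodes r).+1 else 0.

Definition PB n : set pbtree := [set B | nnodes B = n].

Lemma finite_PB n : finite_set (PB n).
Proof.
suff H m : finite_set [set B | (nnodes B <= m)%N].
  by apply: sub_finite_set (H n) => B /= ->.
elim: m => [|m IH].
  by apply: sub_finite_set (finite_set1 Leaf) => -[].
apply: (@sub_finite_set _ _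
  ([set Leaf] `|` [set Node p.1 p.2 | p in
     [set B | (nnodes B <= m)%N] `*` [set B | (nnodes B <= m)%N]])).
  case=> [|l r] /=; first by left.
  rewrite ltnS => h; right; exists (l, r) => //=.
  by split=> /=; apply: leq_trans h; rewrite ?leq_addr ?leq_addl.
by rewrite finite_setU; split=> //; apply/finite_image/finite_setX.
Qed.

(* Search labelling: the labels of B, starting from k, are in order those of
   the left branch, that of the root, and those of the right branch. *)
Definition root_label k B : nat := if B is Node l _ then (k + nnodes l)%N else k.

(* The (parent, child) edges of B, labelled from k. *)
Fixpoint edges_from k B : seq (nat * nat) :=
  if B is Node l r then
    let c := root_label k B in
    (if l is Node _ _ then [:: (c, root_label k l)] else [::]) ++
    (if r is Node _ _ then [:: (c, root_label c.+1 r)] else [::]) ++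
    edges_from k l ++ edges_from c.+1 r
  else [::].

Definition edges B := edges_from 0 B.

Definition adj_without B (e : nat * nat) n : rel 'I_n :=
  fun i j => let E := [seq f <- edges B | f != e] in
    ((val i, val j) \in E) || ((val j, val i) \in E).

(* Connected component, after deletion of e, that misses the root. *)
Definition lower_part n B (e : nat * nat) : {set 'I_n} :=
  [set i : 'I_n | ~~ [exists r : 'I_n,
     (val r == root_label 0 B) && connect (@adj_without B e n) r i]]%SET.

(* Main.v *)
Require Import Defs.
From HB Require Import structures.
From mathcomp Require Import all_boot all_order all_algebra.
From mathcomp Require Import finmap all_classical all_reals.
From mathcomp Require Import topology normedtype.
From mathcomp Require Import zify ring lra.

Set Implicit Arguments.
Unset Strict Implicit.
Unset Printing Implicit Defensive.

Import Order.TTheory GRing.Theory Num.Theory.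
Import numFieldNormedType.Exports.
Local Open Scope ring_scope.

(* Let H be the sum over all intervals [i,j] of min(v_i, ..., v_j). The dual
   cone is {H >= 0} and its boundary is {H = 0}, a section of the projection
   along (1, ..., 1). Each interval minimum is concave and their sum vanishes
   on a cone of a triangulation, so each of them is linear there; hence the
   cone lies in the cone of vectors that increase from parent to child along
   the edges of one binary tree B. That cone is generated modulo
   (1, ..., 1) by the indicators of the sets L_{B,e}, with determinant +-1,
   and restricted to it the form of the volume is linear and vanishes at
   (1, ..., 1) when the sum of the x_ij is 0.

   It remains to see that |det V| / prod_k F(v_k), for a fixed linear form F,
   is additive over subdivisions of a simplicial cone. Expanding a vector a in
   the basis V rewrites F(a) |det V| / prod_k F(v_k) as a signed sum of the
   same expressions for the facets of V. Grouped by the hyperplane that they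
   span, the facets satisfy a relation of the same kind one dimension lower,
   obtained by crossing that hyperplane along a, so that an induction on the
   dimension applies. *)

(** * Linear relations between simplicial cones *)

(** The space is the sum of the line of [a] and the kernel of [u]: the rows of [M] form a basis of
    this kernel, and [Q] gives coordinates in it after projection along [a]. *)
Lemma complement_basis (F : fieldType) n (a : 'rV[F]_n.+1) (u : 'cV[F]_n.+1) :
  a *m u = 1%:M ->
  exists (M : 'M[F]_(n, n.+1)) (Q : 'M[F]_(n.+1, n)),
    [/\ a *m Q = 0, M *m u = 0, M *m Q = 1%:M & u *m a + Q *m M = 1%:M].
Proof.
move=> au1.
have [k0 uk0] : exists k0, u k0 0 != 0.
  apply/existsP; apply: contraT; rewrite negb_exists => /forallP u0.
  have u00 : u = 0.
    by apply/matrixP => i j; rewrite ord1 mxE; move/negPn/eqP: (u0 i).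
  move/matrixP/(_ 0 0): au1; rewrite u00 mulmx0 !mxE /= => /eqP.
  by rewrite eq_sym oner_eq0.
(* [Q0] forgets a coordinate at which [u] is nonzero. [M] is its transpose moved into the kernel of
   [u], and [Q] is its correction that kills [a]. *)
pose Q0 : 'M[F]_(n.+1, n) := \matrix_(l, j) (l == lift k0 j)%:R.
pose e0 : 'rV[F]_n.+1 := delta_mx 0 k0.
pose y : 'cV[F]_n := - (u k0 0)^-1 *: (Q0^T *m u).
pose M := Q0^T + y *m e0; pose Q := Q0 - u *m (a *m Q0).
have e0u : e0 *m u = (u k0 0)%:M.
  by apply/matrixP => i j; rewrite !ord1 -rowE !mxE.
have e0Q : e0 *m Q0 = 0.
  apply/matrixP => i j; rewrite -rowE !mxE.
  by rewrite (negbTE (neq_lift _ _)).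
have QQ : Q0^T *m Q0 = 1%:M.
  apply/matrixP => i j; rewrite !mxE (bigD1 (lift k0 j)) //= big1 ?addr0.
    rewrite !mxE eqxx mulr1; congr (_%:R).
    by rewrite (inj_eq lift_inj) eq_sym.
  by move=> l lj; rewrite !mxE (negbTE lj) mulr0.
have Mu : M *m u = 0.
  rewrite /M mulmxDl -mulmxA e0u /y mul_mx_scalar scalerA mulrN divff //.
  by rewrite scaleN1r subrr.
have MQ : M *m Q = 1%:M.
  rewrite /Q mulmxBr [M *m (u *m _)]mulmxA Mu mul0mx subr0.
  by rewrite /M mulmxDl -mulmxA e0Q mulmx0 addr0 QQ.
have aQ : a *m Q = 0.
  by rewrite /Q mulmxBr [a *m (u *m _)]mulmxA au1 mul1mx subrr.
exists M, Q; split => //.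
rewrite -mul_row_col; apply: (@mulmx1C _ (1 + n)).
by rewrite (@mul_col_row _ 1 n n.+1 1 n) au1 aQ Mu MQ -scalar_mx_block.
Qed.

(** Supplies a step so short that crossing one hyperplane changes the sign of no form that is
    nonzero at the base point. *)
Lemma small_scalar (R : realFieldType) (s : seq (R * R)) :
  (forall p, p \in s -> p.1 != 0) ->
  exists2 e : R, 0 < e & forall p, p \in s -> `|e * p.2| < `|p.1|.
Proof.
elim: s => [|[x y] s IH] H; first by exists 1.
have [p ps|e e0 He] := IH; first by apply: H; rewrite in_cons ps orbT.
have /= x0 := H (x, y) (mem_head _ _).
have y1 : 0 < `|y| + 1 by rewrite ltr_wpDl.
pose d := `|x| / (`|y| + 1).
have d0 : 0 < d by rewrite divr_gt0 ?normr_gt0.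
have m0 : 0 < Order.min e d by rewrite lt_min e0.
exists (Order.min e d) => // p.
rewrite in_cons normrM (gtr0_norm m0) => /predU1P[->|ps] /=.
  apply: (@le_lt_trans _ _ (d * `|y|)).
    by rewrite ler_wpM2r // ge_min lexx orbT.
  rewrite mulrAC ltr_pdivrMr //.
  by rewrite ltr_pM2l ?normr_gt0 // ltrDl.
apply: le_lt_trans (He p ps); rewrite normrM (gtr0_norm e0) ler_wpM2r //.
by rewrite ge_min lexx.
Qed.

Lemma ge0_perturb (R : realFieldType) (x y : R) :
  `|y| < `|x| -> (0 <= x + y) = (0 <= x).
Proof.
case: (lerP 0 x) => x0.
  by rewrite (ger0_norm x0) ltr_norml => /andP[h _]; apply/idP; lra.
rewrite (ltr0_norm x0) ltr_norml => /andP[_ h].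
by apply/negbTE; rewrite -ltNge; lra.
Qed.

(** The values of [h] may range over an infinite type, so the induction is on the number of indices
    and removes one fibre of [h] at a time. *)
Lemma sum_group_eq0 (V : nmodType) (J : finType) (K : eqType) (P : pred J)
    (h : J -> K) (g : J -> V) :
  (forall j0, P j0 -> \sum_(j | P j && (h j == h j0)) g j = 0) ->
  \sum_(j | P j) g j = 0.
Proof.
have [m] := ubnP #|P|; elim: m P => // m IH P leP H.
case: (pickP P) => [j0 Pj0|P0]; last by rewrite big_pred0.
rewrite (bigID (fun j => h j == h j0)) /= H // add0r.
apply: (IH (fun j => P j && (h j != h j0))).
  apply: leq_trans (leP : (_ <= m)%N); apply/proper_card/properP; split.
    by apply/fintype.subsetP => j /andP[].
  by exists j0; rewrite ?inE // unfold_in eqxx andbF.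
move=> j1 /andP[Pj1 hj1]; rewrite -[RHS](H _ Pj1); apply: eq_bigl => j.
by case: (h j =P h j1) => [->|]; rewrite ?hj1 ?andbT ?andbF.
Qed.

(** For invertible [V], membership in the closed cone spanned by the rows: [y *m invmx V] lists the
    coordinates of [y] in that basis. *)
Definition in_cone (R : realFieldType) n (V : 'M[R]_n) (y : 'rV[R]_n) : bool :=
  [forall k, 0 <= (y *m invmx V) 0 k].

(** * Facets of a simplicial cone, in coordinates of their hyperplane *)

Section Facet.
Variables (F : realFieldType) (n : nat) (V : 'M[F]_n.+1) (k : 'I_n.+1).
Variables (a : 'rV[F]_n.+1) (u : 'cV[F]_n.+1) (al : F).
Variables (M : 'M[F]_(n, n.+1)) (Q : 'M[F]_(n.+1, n)).
Hypotheses (Vu : V \in unitmx) (al0 : al != 0).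
Hypothesis (uV : col k (invmx V) = al *: u).
Hypothesis (uaQM : u *m a + Q *m M = 1%:M).

(** Column [k] of [invmx V] is the form dual to row [k], so it vanishes on all other rows. *)
Lemma facet_vanish : row' k V *m u = 0.
Proof.
apply: (scalerI al0); rewrite scaler0 scalemxAr -uV.
apply/matrixP => i j.
rewrite row'Esub colE mulmxA mul_rowsub_mx mulmxV // -colE !mxE.
by rewrite eq_sym (negbTE (neq_lift _ _)).
Qed.

(** [Q *m M] is the projection onto the kernel of [u] along [a], and the facet lies in this
    kernel. *)
Lemma facet_proj : row' k V *m Q *m M = row' k V.
Proof.
have := congr1 (mulmx (row' k V)) uaQM.
by rewrite mulmxDr mulmxA facet_vanish mul0mx add0r mulmxA mulmx1.
Qed.

(** The dual basis of the facet consists of the other dual forms of [V], restricted to the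
    hyperplane. *)
Lemma facet_invmx :
  row' k V *m Q \in unitmx /\
  invmx (row' k V *m Q) = M *m col' k (invmx V).
Proof.
have W1 : (row' k V *m Q) *m (M *m col' k (invmx V)) = 1%:M.
  rewrite mulmxA facet_proj row'Esub col'Esub -mxsub_mul mulmxV //.
  by apply/matrixP => i j; rewrite !mxE (inj_eq lift_inj).
have [WU _] := mulmx1_unit W1; split=> //.
by rewrite -[LHS]mulmx1 -W1 mulKmx.
Qed.

(** In the product of [V] with [row_mx u Q], the first column has the single nonzero entry [al^-1],
    in row [k]; expansion along it leaves the facet minor. *)
Lemma facet_det :
  `|\det V| * `|\det (row_mx u Q : 'M[F]_n.+1)| * `|al| =
  `|\det (row' k V *m Q)|.
Proof.
have VU : al *: (V *m u) = col k 1%:M.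
  by rewrite scalemxAr -uV colE mulmxA mulmxV // -colE.
have Vu0 i : (V *m u) i 0 = al^-1 * (i == k)%:R.
  have /matrixP/(_ i 0) := VU; rewrite !mxE => <-.
  by rewrite mulKf.
rewrite -!normrM -det_mulmx (@mul_mx_row _ n.+1 n.+1 1 n V u Q).
have X0 i : row_mx (V *m u) (V *m Q) i 0 = al^-1 * (i == k)%:R.
  have -> : (0 : 'I_n.+1) = lshift n (0 : 'I_1) by apply: val_inj.
  by rewrite (row_mxEl (V *m u)).
have XS i j : row_mx (V *m u) (V *m Q) i (lift 0 j) = (V *m Q) i j.
  have -> : lift (0 : 'I_n.+1) j = rshift 1 j by apply: val_inj.
  by rewrite (row_mxEr (V *m u)).
rewrite (expand_det_col _ 0) (bigD1 k) //= big1 ?addr0 => [|i ik]; last first.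
  by rewrite X0 (negbTE ik) mulr0 mul0r.
rewrite X0 eqxx mulr1 mulrAC mulVf // mul1r /cofactor normrM normrX normrN1.
rewrite expr1n mul1r; congr (`|\det _|); apply/matrixP => i j.
by rewrite row'Esub mul_rowsub_mx 2!mxE [LHS]XS !mxE.
Qed.

Lemma facet_in_cone (y : 'rV[F]_n) :
  in_cone (row' k V *m Q) y =
  [forall j, 0 <= (y *m M *m invmx V) 0 (lift k j)].
Proof.
apply: eq_forallb => j.
by rewrite (proj2 facet_invmx) mulmxA col'Esub mulmx_colsub mxE.
Qed.

End Facet.

(* The point [y *m M] lies on the hyperplane [u], which [a] crosses. *)
Lemma cone_jump (R : realFieldType) n (V : 'M[R]_n.+1) (a : 'rV[R]_n.+1)
    (u : 'cV[R]_n.+1) (M : 'M[R]_(n, n.+1)) (Q : 'M[R]_(n.+1, n))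
    (y : 'rV[R]_n) (e : R) :
  V \in unitmx -> a *m u = 1%:M -> M *m u = 0 -> u *m a + Q *m M = 1%:M ->
  0 < e ->
  (forall l, M *m col l (invmx V) != 0 -> (y *m M *m invmx V) 0 l != 0) ->
  (forall l, (y *m M *m invmx V) 0 l != 0 ->
     `|e * (a *m invmx V) 0 l| < `|(y *m M *m invmx V) 0 l|) ->
  (in_cone V (y *m M + e *: a))%:R - (in_cone V (y *m M - e *: a))%:R =
  \sum_(k | ((a *m invmx V) 0 k != 0) &&
             (((a *m invmx V) 0 k)^-1 *: col k (invmx V) == u))
     Num.sg ((a *m invmx V) 0 k) * (in_cone (row' k V *m Q) y)%:R :> R.
Proof.
move=> VU au Mu uaQM e0 gen small.
pose al k := (a *m invmx V) 0 k; pose p k := (y *m M *m invmx V) 0 k.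
have colE' (z : 'rV_n.+1) k : (z *m invmx V) 0 k = (z *m col k (invmx V)) 0 0.
  by rewrite colE mulmxA -colE [RHS]mxE.
(* A dual form that vanishes on the hyperplane is a multiple of [u]. *)
have Mcol k : M *m col k (invmx V) = 0 -> col k (invmx V) = al k *: u.
  move=> M0; rewrite -[LHS]mul1mx -uaQM mulmxDl -!mulmxA M0 mulmx0 addr0.
  by rewrite [a *m _]mx11_scalar mul_mx_scalar -colE'.
have al_neq0 k : M *m col k (invmx V) = 0 -> al k != 0.
  move=> /Mcol cE; apply/negP => /eqP al0; move: cE; rewrite al0 scale0r.
  move=> /(congr1 (mulmx V)); rewrite mulmx0 colE mulmxA mulmxV // mul1mx.
  by move=> /matrixP/(_ k 0)/eqP; rewrite !mxE !eqxx oner_eq0.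
have p0 k : M *m col k (invmx V) = 0 -> p k = 0.
  by move=> M0; rewrite /p colE' -mulmxA M0 mulmx0 mxE.
have inE z : in_cone V (y *m M + z *: a) = [forall k, 0 <= p k + z * al k].
  by apply: eq_forallb => k; rewrite mulmxDl -scalemxAl mxE [X in _ + X]mxE.
rewrite inE -scaleNr inE.
have far k z : `|z| = e -> p k != 0 -> (0 <= p k + z * al k) = (0 <= p k).
  move=> ze pk; apply: ge0_perturb.
  by rewrite normrM ze -(gtr0_norm e0) -normrM small.
(* At most one facet of [V] spans the hyperplane. If none does, no sign changes between the two
   points and the sum on the right is empty. *)
have [/existsP[k /eqP Mk]|/existsPn none] :=
    boolP [exists k, M *m col k (invmx V) == 0]; last first.
  rewrite [RHS]big1 => [|k /andP[al0 /eqP uE]]; last first.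
    case/eqP: (none k).
    have -> : col k (invmx V) = al k *: u.
      by rewrite -uE scalerA mulfV // scale1r.
    by rewrite -scalemxAr Mu scaler0.
  apply/eqP; rewrite subr_eq0; apply/eqP; congr (_%:R).
  apply: congr1; apply: eq_forallb => k.
  by rewrite !far ?normrN ?gtr0_norm //; apply: gen.
have uk : col k (invmx V) = al k *: u by exact: Mcol.
have alk := al_neq0 k Mk.
have uniqk l : l != k -> M *m col l (invmx V) != 0.
  move=> lk; apply/eqP => Ml; have ul := Mcol l Ml; have all := al_neq0 l Ml.
  have /(congr1 (mulmx V)) : al k *: col l (invmx V) = al l *: col k (invmx V).
    by rewrite uk ul !scalerA mulrC.
  rewrite -!scalemxAr !colE !mulmxA mulmxV // !mul1mx => /matrixP/(_ l 0)/eqP.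
  by rewrite !mxE !eqxx (negbTE lk) mulr0 mulr1 (negbTE alk).
rewrite (big_pred1 k) => [|l]; last first.
  rewrite /=; apply/andP/eqP => [[al0 /eqP uE]|->].
    apply/eqP/negPn/negP => /uniqk/eqP; apply.
    have -> : col l (invmx V) = al l *: u.
      by rewrite -uE scalerA mulfV // scale1r.
    by rewrite -scalemxAr Mu scaler0.
  split => //; rewrite -/(al k) uk scalerA mulVf // scale1r.
  by [].
have plift j : p (lift k j) != 0 by apply/gen/uniqk; rewrite eq_sym neq_lift.
have facetE z : `|z| = e -> [forall l, 0 <= p l + z * al l] =
    (0 <= z * al k) && in_cone (row' k V *m Q) y.
  move=> ze; rewrite (facet_in_cone VU alk uk uaQM).
  apply/forallP/andP => [H|[H1 /forallP H2] l].
    split; first by have := H k; rewrite (p0 k Mk) add0r.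
    apply/forallP => j; have := H (lift k j).
    by rewrite far.
  case: (unliftP k l) => [j ->|->]; last by rewrite p0 // add0r.
  by rewrite far //; apply: H2.
rewrite !facetE ?normrN ?gtr0_norm // -/(al k).
case: (in_cone _ y); rewrite ?andbT ?andbF ?mulr0 ?subrr // mulr1.
(* At a point of the facet, moving along [a] enters the cone when [al k > 0] and leaves it when
   [al k < 0]. *)
rewrite mulNr oppr_ge0 (pmulr_rge0 _ e0) (pmulr_rle0 _ e0).
case: (ltgtP (al k) 0) alk => // [al0|al0] _.
  by rewrite sub0r ltr0_sg.
by rewrite subr0 gtr0_sg.
Qed.

(** Closed cones overlap along faces, so the relation between indicators is only asked off the
    hyperplanes of [Hs]. The coefficients [c] are arbitrary because the descent to facets brings in
    signs. *)
Theorem cone_relation (R : realFieldType) n : forall (I : finType) (P : pred I)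
    (V : I -> 'M[R]_n) (c : I -> R) (f : 'cV[R]_n) (Hs : seq 'cV[R]_n),
  (forall i, P i -> V i \in unitmx) ->
  (forall i k, P i -> (V i *m f) k 0 != 0) ->
  (forall h, h \in Hs -> h != 0) ->
  (forall y : 'rV[R]_n, (forall h, h \in Hs -> (y *m h) 0 0 != 0) ->
     \sum_(i | P i) c i * (in_cone (V i) y)%:R = 0) ->
  \sum_(i | P i) c i * (`|\det (V i)| / \prod_k (V i *m f) k 0) = 0.
Proof.
elim: n => [|n IH] I P V c f Hs VU Vf H0 rel.
  (* In dimension 0 every vector is 0, so [Hs] is empty and the relation at [0] is the claim. *)
  have Hs0 h : h \in Hs -> h = 0 by move=> _; apply/matrixP => -[].
  rewrite -[RHS](rel 0) => [|h hH]; last by case/eqP: (H0 h hH); apply: Hs0.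
  apply: eq_bigr => i Pi; rewrite det_mx00 normr1 big_ord0 divr1.
  by have -> : in_cone (V i) 0 by apply/forallP => -[].
case: (pickP P) => [i0 Pi0|P0]; last by rewrite big_pred0.
pose a := row 0 (V i0).
have af0 : (a *m f) 0 0 != 0 by rewrite -row_mul mxE Vf.
apply: (mulfI af0); rewrite mulr0.
pose al i k := (a *m invmx (V i)) 0 k.
(* The facet form scaled to be 1 at [a]: facets with [al] nonzero share it exactly when they span
   the same hyperplane. *)
pose ut (j : I * 'I_n.+1) := (al j.1 j.2)^-1 *: col j.2 (invmx (V j.1)).
pose g (j : I * 'I_n.+1) := c j.1 * (`|\det (V j.1)| * al j.1 j.2 /
  \prod_l (V j.1 *m f) (lift j.2 l) 0).
have -> : (a *m f) 0 0 *
    (\sum_(i | P i) c i * (`|\det (V i)| / \prod_k (V i *m f) k 0)) =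
    \sum_(j | P j.1 && (al j.1 j.2 != 0)) g j.
  transitivity (\sum_(i | P i) \sum_(k | al i k != 0) g (i, k)); last first.
    by rewrite pair_big_dep; apply: eq_bigr => -[].
  rewrite mulr_sumr; apply: eq_bigr => i Pi.
  have -> : (a *m f) 0 0 = \sum_k al i k * (V i *m f) k 0.
    by rewrite -[in LHS](mulmxKV (VU i Pi) a) -(mulmxA _ (V i)) [LHS]mxE.
  rewrite mulr_suml [RHS]big_mkcond; apply: eq_bigr => k _.
  case: eqP => [->|_] /=; first by rewrite !mul0r.
  rewrite /g /= (bigD1_ord k) //=.
  have Pn0 : \prod_(l < n) (V i *m f) (lift k l) 0 != 0.
    by apply/prodf_neq0 => l _; apply: Vf.
  have := Vf i k Pi; move: Pn0; set X := \prod_(_ < _) _; set Y := (_ *m _) k 0.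
  by move=> X0 Y0; field; rewrite X0.
apply: (@sum_group_eq0 _ _ _ _ ut) => -[i1 k1] /andP[/= Pi1 al1].
set u := ut (i1, k1).
have colE' (z : 'rV_n.+1) (X : 'M[R]_n.+1) k :
    (z *m X) 0 k = (z *m col k X) 0 0.
  by rewrite colE mulmxA -colE [RHS]mxE.
have au : a *m u = 1%:M.
  rewrite [LHS]mx11_scalar; congr (_%:M).
  by rewrite /u /ut -scalemxAr mxE -colE' mulVf.
have [M [Q [aQ Mu MQ uaQM]]] := complement_basis au.
have detuQ : \det (row_mx u Q : 'M_n.+1) != 0.
  rewrite -unitfE -[_ \is a _]/(_ \in unitmx).
  have : (row_mx u Q : 'M_n.+1) *m (col_mx a M : 'M_n.+1) = 1%:M.
    by rewrite -uaQM -mul_row_col.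
  by case/mulmx1_unit.
pose P' (j : I * 'I_n.+1) := P j.1 && (al j.1 j.2 != 0) && (ut j == u).
have colu j : P' j -> col j.2 (invmx (V j.1)) = al j.1 j.2 *: u.
  by case/andP => /andP[_ al0] /eqP <-; rewrite scalerA mulfV // scale1r.
pose V' (j : I * 'I_n.+1) := row' j.2 (V j.1) *m Q.
pose c' (j : I * 'I_n.+1) := c j.1 * Num.sg (al j.1 j.2).
pose Us :=
  [seq col j.2 (invmx (V j.1)) | j <- enum [pred j : I * 'I_n.+1 | P j.1]].
(* [M *m h] is the restriction of [h] to the hyperplane; forms that restrict to 0 are dropped, as
   the induction hypothesis wants nonzero ones. *)
pose Hs' := [seq h <- [seq M *m h | h <- Us ++ Hs] | h != 0].
have := IH _ P' V' c' (M *m f) Hs'.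
have V'f j l : P' j -> (V' j *m (M *m f)) l 0 = (V j.1 *m f) (lift j.2 l) 0.
  move=> P'j; have /andP[/andP[Pj alj] _] := P'j.
  rewrite mulmxA (facet_proj (VU _ Pj) alj (colu j P'j) uaQM).
  by rewrite row'Esub mul_rowsub_mx mxE.
have gE j : P' j ->
    g j = c' j * (`|\det (V' j)| / \prod_k (V' j *m (M *m f)) k 0)
    / `|\det (row_mx u Q : 'M_n.+1)|.
  move=> P'j; have /andP[/andP[Pj alj] _] := P'j.
  rewrite (eq_bigr _ (fun l _ => V'f j l P'j)) /g /c'.
  rewrite -(facet_det Q (VU _ Pj) alj (colu j P'j)).
  rewrite [X in `|_| * X / _]numEsg.
  have D0 : `|\det (row_mx u Q : 'M_n.+1)| != 0 by rewrite normr_eq0.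
  set E := \prod_l _; have E0 : E != 0 by apply/prodf_neq0 => l _; apply: Vf.
  move: D0; move: (`|\det (row_mx u Q : 'M_n.+1)|) => D D0.
  by field; rewrite D0.
move=> IH'; rewrite (eq_bigr _ gE) -mulr_suml IH' ?mul0r //.
- move=> j P'j; have /andP[/andP[Pj alj] _] := P'j.
  by have [] := facet_invmx (VU _ Pj) alj (colu j P'j) uaQM.
- by move=> j l P'j; rewrite V'f //; apply: Vf; case/andP: P'j => /andP[].
- by move=> h; rewrite mem_filter => /andP[].
move=> y geny.
have gen h : h \in Us ++ Hs -> M *m h != 0 -> (y *m M *m h) 0 0 != 0.
  move=> hU Mh; rewrite -mulmxA; apply: geny.
  by rewrite mem_filter Mh map_f.
pose s := [seq p <- [seq ((y *m M *m h) 0 0, (a *m h) 0 0) | h <- Us ++ Hs] |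
  p.1 != 0].
have [p|e e0 He] := @small_scalar R s; first by rewrite mem_filter => /andP[].
have small h : h \in Us ++ Hs -> (y *m M *m h) 0 0 != 0 ->
    `|e * (a *m h) 0 0| < `|(y *m M *m h) 0 0|.
  move=> hU yh; apply: (He ((y *m M *m h) 0 0, (a *m h) 0 0)).
  by rewrite mem_filter yh; apply/mapP; exists h.
have UsP i k : P i -> col k (invmx (V i)) \in Us ++ Hs.
  move=> Pi; rewrite mem_cat; apply/orP; left; apply/mapP.
  by exists (i, k) => //; rewrite mem_enum.
(* A form of [Hs] that restricts to 0 on the hyperplane is nonzero at [a]; any other one is
   dominated by its value at [y]. *)
have H1 h z : h \in Hs -> `|z| = e -> ((y *m M + z *: a) *m h) 0 0 != 0.
  move=> hH ze; have hU : h \in Us ++ Hs by rewrite mem_cat hH orbT.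
  rewrite mulmxDl -scalemxAl mxE [X in _ + X]mxE.
  have [Mh|Mh] := eqVneq (M *m h) 0.
    rewrite -[_ *m h]mulmxA Mh mulmx0 mxE add0r mulf_neq0 //.
      by rewrite -normr_eq0 ze gt_eqF.
    apply/eqP => ah; case/eqP: (H0 h hH).
    rewrite -[h]mul1mx -uaQM mulmxDl -!mulmxA Mh mulmx0 addr0.
    by rewrite [a *m h]mx11_scalar ah raddf0 mulmx0.
  have yh := gen h hU Mh; have := small h hU yh.
  rewrite !normrM gtr0_norm // -ze -normrM => lt.
  apply/eqP => /eqP; rewrite addr_eq0 => /eqP yE.
  by move: lt; rewrite yE normrN ltxx.
(* The relation is taken at one point on each side of the hyperplane; in the difference only the
   facets that span it survive. *)
have := congr2 (fun x y => x - y) (rel _ (fun h hH => H1 h e hH (gtr0_norm e0)))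
  (rel _ (fun h hH => H1 h (- e) hH (etrans (normrN _) (gtr0_norm e0)))).
rewrite /= subrr -sumrB => rel0; rewrite -[RHS]rel0.
transitivity (\sum_(i | P i) \sum_(k | (al i k != 0) && (ut (i, k) == u))
    c' (i, k) * (in_cone (V' (i, k)) y)%:R).
  rewrite pair_big_dep; apply: eq_big => [j|[i k] _] //=.
  by rewrite andbA; case: j.
apply: eq_bigr => i Pi.
rewrite -mulrBr scaleNr (cone_jump (VU i Pi) au Mu uaQM e0).
- by rewrite mulr_sumr; apply: eq_bigr => k _; rewrite mulrA.
- by move=> l Ml; rewrite colE'; apply: gen => //; apply: UsP.
by move=> l; rewrite !colE'; apply: small; apply: UsP.
Qed.

(** * Plane binary trees *)

(** The second pair is the half-open interval of labels of the branch below the edge; the edges come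
    in the order of [edges_from]. *)
Fixpoint edge_branches k B : seq ((nat * nat) * (nat * nat)) :=
  if B is Node l r then
    let c := root_label k B in
    (if l is Node _ _ then [:: ((c, root_label k l), (k, c))] else [::]) ++
    (if r is Node _ _ then
       [:: ((c, root_label c.+1 r), (c.+1, (c.+1 + nnodes r)%N))] else [::]) ++
    edge_branches k l ++ edge_branches c.+1 r
  else [::].

Lemma edges_from_branches k B : edges_from k B = unzip1 (edge_branches k B).
Proof.
elim: B k => [|l IHl r IHr] k //=.
rewrite /unzip1 !map_cat IHl IHr.
by case: l {IHl} => [|? ?]; case: r {IHr}.
Qed.

Lemma size_edges_from k B : size (edges_from k B) = (nnodes B).-1.
Proof.
elim: B k => [|l IHl r IHr] k //=; rewrite !size_cat IHl IHr.
by case: l {IHl} => [|? ?]; case: r {IHr} => [|? ?] //=; lia.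
Qed.

Lemma root_label_bounds k B : (0 < nnodes B)%N ->
  (k <= root_label k B < k + nnodes B)%N.
Proof. by case: B => //= l r _; lia. Qed.

Lemma edges_from_bounds k B (e : nat * nat) : e \in edges_from k B ->
  (k <= e.1 < k + nnodes B)%N /\ (k <= e.2 < k + nnodes B)%N.
Proof.
elim: B k => [|l IHl r IHr] k //=; rewrite !mem_cat => /or4P[].
- case: l {IHl} => //= l1 l2; rewrite inE => /eqP -> /=; lia.
- case: r {IHr} => //= l1 l2; rewrite inE => /eqP -> /=; lia.
- by move=> /IHl; lia.
- by move=> /IHr; lia.
Qed.

Section Ordered.
Variable R : realDomainType.
Implicit Type v : nat -> R.

Definition ordered k B v := all (fun e => v e.1 <= v e.2) (edges_from k B).

Lemma orderedN k l r v : ordered k (Node l r) v ->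
  ordered k l v /\ ordered (k + nnodes l).+1 r v.
Proof. by rewrite /ordered /= !all_cat => /and4P[]. Qed.

Lemma ordered_root k B v : ordered k B v ->
  forall j, (k <= j < k + nnodes B)%N -> v (root_label k B) <= v j.
Proof.
elim: B k => [|l IHl r IHr] k o j /=; first lia.
have [ol or] := orderedN o; move=> jB.
have [jl|jr|->//] := ltngtP j (k + nnodes l).
  apply: le_trans (IHl k ol j _); last lia.
  move: o; rewrite /ordered /= !all_cat => /andP[].
  case: l {IHl ol or} jl jB => /= [|l1 l2 _ _]; first lia.
  by rewrite andbT.
apply: le_trans (IHr _ or j _); last lia.
move: o; rewrite /ordered /= !all_cat => /and3P[_].
case: r {IHr or} jr jB => /= [|l1 l2 _ _]; first lia.
by rewrite andbT.
Qed.

(* All labels between those of a parent and of its child belong to the branch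
   of the child. *)
Lemma ordered_edge_min k B v (e : nat * nat) t :
  ordered k B v -> e \in edges_from k B ->
  (minn e.1 e.2 <= t <= maxn e.1 e.2)%N -> v e.1 <= v t.
Proof.
elim: B k => [|l IHl r IHr] k //= o; have [ol or] := orderedN o.
rewrite !mem_cat => /or4P[eE|eE|/IHl|/IHr]; [| |exact|exact].
- move=> ht; have := ordered_root o (j := t) => /=.
  case: l {IHl ol or o} eE ht => //= l1 l2.
  by rewrite inE => /eqP -> /= ht; apply; lia.
- move=> ht; have := ordered_root o (j := t) => /=.
  case: r {IHr or o} eE ht => //= l1 l2.
  by rewrite inE => /eqP -> /= ht; apply; lia.
Qed.

(** The topmost node of the interval serves for every [v] at once: descend from the root until its
    label falls between [i] and [j]. *)
Lemma ordered_argmin k B i j :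
  (k <= i)%N -> (i <= j)%N -> (j < k + nnodes B)%N ->
  exists2 m, (i <= m <= j)%N &
    forall v, ordered k B v -> forall t, (i <= t <= j)%N -> v m <= v t.
Proof.
elim: B k => [|l IHl r IHr] k ki ij /= jB; first lia.
have [il|il] := ltnP (k + nnodes l) i.
  have [|//||m mij H] := IHr (k + nnodes l).+1; [lia|lia|].
  by exists m => // v /orderedN[_]; apply: H.
have [lj|lj] := ltnP j (k + nnodes l).
  have [//|//||m mij H] := IHl k; first lia.
  by exists m => // v /orderedN[+ _]; apply: H.
exists (k + nnodes l)%N; first lia.
by move=> v o t tij; apply: (ordered_root o); rewrite /=; lia.
Qed.

Lemma exists_argmin v k m : exists2 c, (k <= c < k + m.+1)%N &
  forall j, (k <= j < k + m.+1)%N -> v c <= v j.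
Proof.
elim: m => [|m [c cb H]].
  by exists k => [|j jb]; first lia; have -> : j = k by lia.
have [h|h] := lerP (v c) (v (k + m.+1)%N).
  exists c => [|j jb]; first lia.
  have [->//|nj] := eqVneq j (k + m.+1)%N.
  by apply: H; lia.
exists (k + m.+1)%N => [|j jb]; first lia.
have [->//|nj] := eqVneq j (k + m.+1)%N.
by apply: le_trans (ltW h) (H _ _); lia.
Qed.

(** Cartesian tree: a position of the minimum becomes the root, and the two sides are treated
    recursively. *)
Lemma exists_ordered v k m : exists2 B, nnodes B = m & ordered k B v.
Proof.
have [N] := ubnP m; elim: N k m => // N IH k [|m] mN; first by exists Leaf.
have [c cb H] := exists_argmin v k m.
have [|l ln ol] := IH k (c - k)%N; first lia.
have [|r rn or] := IH c.+1 (k + m - c)%N; first lia.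
exists (Node l r) => /=; first by rewrite ln rn; lia.
have cE : (k + nnodes l = c)%N by lia.
rewrite /ordered /= !all_cat cE; apply/and4P; split => //.
- case: l ln {ol cE} => //= l1 l2 nE; rewrite andbT; apply: H; lia.
- case: r rn {or} => //= l1 l2 nE; rewrite andbT; apply: H; lia.
Qed.

(** With distinct values the root must be the only minimum, which determines the tree from the top
    down. *)
Lemma ordered_inj v k B B' : nnodes B = nnodes B' ->
  (forall i j, (k <= i < k + nnodes B)%N -> (k <= j < k + nnodes B)%N ->
     v i = v j -> i = j) ->
  ordered k B v -> ordered k B' v -> B = B'.
Proof.
elim: B k B' => [|l IHl r IHr] k [|l' r'] //= [nE] inj o o'.
have cE : (k + nnodes l = k + nnodes l')%N.
  apply: inj; try lia; apply: le_anti; apply/andP; split.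
    by apply: (ordered_root o) => /=; lia.
  by apply: (ordered_root o') => /=; lia.
have [ol or] := orderedN o; have [ol' or'] := orderedN o'.
rewrite -cE in or'.
rewrite (IHl k l') //; try lia; last by move=> i j ib jb; apply: inj; lia.
rewrite (IHr (k + nnodes l).+1 r') //; try lia.
by move=> i j ib jb; apply: inj; lia.
Qed.

End Ordered.

Lemma branch_bounds k B (d : (nat * nat) * (nat * nat)) :
  d \in edge_branches k B ->
  (k <= d.2.1 <= d.2.2)%N && (d.2.2 <= k + nnodes B)%N.
Proof.
elim: B k => [|l IHl r IHr] k //=; rewrite !mem_cat => /or4P[].
- case: l {IHl} => //= l1 l2; rewrite inE => /eqP -> /=; lia.
- case: r {IHr} => //= l1 l2; rewrite inE => /eqP -> /=; lia.
- by move=> /IHl; lia.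
- by move=> /IHr; lia.
Qed.

(** The differences telescope along the path from the root to [j], since the branches that contain
    [j] are those below the edges of this path. *)
Lemma edge_expansion (R : nzRingType) (v : nat -> R) k B j :
  (k <= j < k + nnodes B)%N ->
  v j = v (root_label k B) + \sum_(d <- edge_branches k B)
          (v d.1.2 - v d.1.1) * (d.2.1 <= j < d.2.2)%N%:R.
Proof.
elim: B k j => [|l IHl r IHr] k j /= jB; first lia.
rewrite !big_cat /=.
have [c cE] : {c | c = k + nnodes l}%N by exists (k + nnodes l)%N.
rewrite -cE.
pose term (d : (nat * nat) * (nat * nat)) : R :=
  (v d.1.2 - v d.1.1) * (d.2.1 <= j < d.2.2)%N%:R.
have out k' B' : ~~ (k' <= j < k' + nnodes B')%N ->
    \sum_(d <- edge_branches k' B') term d = 0.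
  move=> jB'; apply: big1_seq => -[[a b] [lo hi]] /= /branch_bounds /= dB.
  by rewrite /term /= (_ : (lo <= j < hi)%N = false) ?mulr0 //; lia.
have hl : \sum_(d <- (if l is Node _ _ then [:: ((c, root_label k l), (k, c))]
    else [::])) term d = if (j < c)%N then v (root_label k l) - v c else 0.
  case: l {IHl} cE jB => /= [|l1 l2] cE jB.
    by rewrite big_nil ifF //; lia.
  rewrite big_seq1 /term /=; have -> : (k <= j < c)%N = (j < c)%N by lia.
  by case: ifP; rewrite ?mulr1 ?mulr0.
have hr : \sum_(d <- (if r is Node _ _ then
      [:: ((c, root_label c.+1 r), (c.+1, (c.+1 + nnodes r)%N))]
    else [::])) term d = if (c < j)%N then v (root_label c.+1 r) - v c else 0.
  case: r {IHr} jB => [|l1 l2] /= jB; first by rewrite big_nil ifF //; lia.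
  rewrite big_seq1 /term /=.
  have -> : (c < j < c.+1 + (nnodes l1 + nnodes l2).+1)%N = (c < j)%N by lia.
  by case: ifP; rewrite ?mulr1 ?mulr0.
rewrite [X in v _ + (X + _)]hl [X in _ + (_ + (X + _))]hr.
have [jl|jl|jE] := ltngtP j c.
- rewrite (out c.+1 r) ?add0r ?addr0; last lia.
  by rewrite -addrA addrCA addNKr -IHl //; lia.
- rewrite (out k l) ?add0r ?addr0; last lia.
  by rewrite -addrA addrCA addNKr -IHr //; lia.
by rewrite !out ?addr0 -?jE //; lia.
Qed.

(** * Coordinates adapted to a tree *)

Definition branch B k := nth ((0, 0), (0, 0))%N (edge_branches 0 B) k.
Definition in_branch B k (j : nat) :=
  ((branch B k).2.1 <= j < (branch B k).2.2)%N.

(** A row vector times [root_col] is its value at the root, and times [edge_mx] its increments along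
    the edges. The dual basis is (1, ..., 1) with the rows of [branch_mx], the indicators of the
    branches. *)
Definition root_col (S : nzRingType) n B : 'cV[S]_n.+1 :=
  \col_j (j == root_label 0 B :> nat)%:R.
Definition edge_mx (S : nzRingType) n B : 'M[S]_(n.+1, n) :=
  \matrix_(j, k) ((j == (branch B k).1.2 :> nat)%:R -
                  (j == (branch B k).1.1 :> nat)%:R).
Definition branch_mx (S : nzRingType) n B : 'M[S]_(n, n.+1) :=
  \matrix_(k, j) (in_branch B k j)%:R.

Section TreeMatrices.
Variables (n : nat) (B : pbtree).
Hypothesis nB : nnodes B = n.+1.

Lemma size_edge_branches : size (edge_branches 0 B) = n.
Proof.
by rewrite -(size_map fst) -[map _ _]edges_from_branches size_edges_from nB.
Qed.

Lemma branch_edge_mem (k : 'I_n) : (branch B k).1 \in edges B.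
Proof.
rewrite /edges edges_from_branches; apply: map_f; apply: mem_nth.
by rewrite size_edge_branches.
Qed.

Lemma edge_branchP e : e \in edges B -> exists k : 'I_n, e = (branch B k).1.
Proof.
rewrite /edges edges_from_branches => /mapP[d dE ->].
have id : (index d (edge_branches 0 B) < n)%N.
  by rewrite -size_edge_branches index_mem.
by exists (Ordinal id); rewrite /branch nth_index.
Qed.

Lemma branch_edge_bounds (k : 'I_n) :
  ((branch B k).1.1 < n.+1)%N /\ ((branch B k).1.2 < n.+1)%N.
Proof.
by have := edges_from_bounds (branch_edge_mem k); rewrite nB => -[]; lia.
Qed.

Lemma root_label_lt : (root_label 0 B < n.+1)%N.
Proof. by have := @root_label_bounds 0 B; rewrite nB; lia. Qed.

Lemma branch_expansion (S : nzRingType) (v : nat -> S) (j : 'I_n.+1) :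
  v j = v (root_label 0 B) + \sum_(k < n)
    (v (branch B k).1.2 - v (branch B k).1.1) * (in_branch B k j)%:R.
Proof.
rewrite [LHS](@edge_expansion _ v 0 B) ?nB ?add0n ?ltn_ord //; congr (_ + _).
rewrite (big_nth ((0, 0), (0, 0))%N) size_edge_branches big_mkord.
by apply: eq_bigr.
Qed.

Lemma tree_basis (S : nzRingType) :
  root_col S n B *m const_mx 1 + edge_mx S n B *m branch_mx S n B = 1%:M.
Proof.
apply/matrixP => i j; rewrite !mxE big_ord1 !mxE mulr1.
have -> : (i == j) = (i == j :> nat) by [].
rewrite [RHS](branch_expansion (fun l => (i == l :> nat)%:R)); congr (_ + _).
by apply: eq_bigr => k _; rewrite !mxE.
Qed.

(** Over a commutative ring a one-sided inverse of a square matrix is two-sided; the four identities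
    are the blocks of the reversed product. *)
Lemma tree_dual_basis (S : comNzRingType) :
  [/\ const_mx 1 *m root_col S n B = 1%:M,
      (const_mx 1 : 'rV_n.+1) *m edge_mx S n B = 0,
      branch_mx S n B *m root_col S n B = 0 &
      branch_mx S n B *m edge_mx S n B = 1%:M].
Proof.
have : (row_mx (root_col S n B) (edge_mx S n B) : 'M_n.+1) *m
    (col_mx (const_mx 1 : 'rV_n.+1) (branch_mx S n B) : 'M_n.+1) = 1%:M.
  by rewrite -tree_basis -mul_row_col.
move/mulmx1C; rewrite (@mul_col_row _ 1 n n.+1 1 n).
rewrite (_ : 1%:M = block_mx 1%:M 0 0 1%:M :> 'M[S]_(1 + n)).
  by case/(@eq_block_mx _ 1 n 1 n).
exact: scalar_mx_block.
Qed.

(* The inverse matrices are integral, so that their determinants are +-1. *)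
Lemma norm_det_tree (R : numDomainType) :
  `|\det (row_mx (root_col R n B) (edge_mx R n B) : 'M_n.+1)| = 1.
Proof.
have : (row_mx (root_col int n B) (edge_mx int n B) : 'M_n.+1) *m
    (col_mx (const_mx 1 : 'rV_n.+1) (branch_mx int n B) : 'M_n.+1) = 1%:M.
  by rewrite -tree_basis -mul_row_col.
move/(congr1 determinant); rewrite det_mulmx det1 => /(congr1 absz)/eqP.
rewrite abszM muln_eq1 => /andP[/eqP d1 _].
have -> : (row_mx (root_col R n B) (edge_mx R n B) : 'M_n.+1) =
    map_mx intr (row_mx (root_col int n B) (edge_mx int n B) : 'M_n.+1).
  rewrite [RHS](@map_row_mx _ _ _ n.+1 1 n).
  have -> : map_mx intr (root_col int n B) = root_col R n B.
    by apply/matrixP => i j; rewrite !mxE; case: (_ == _).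
  have -> // : map_mx intr (edge_mx int n B) = edge_mx R n B.
  by apply/matrixP => i j; rewrite !mxE rmorphB /=; do 2!case: (_ == _).
by rewrite det_map_mx -intr_norm -abszE d1.
Qed.

Lemma mul_edge_mx (S : nzRingType) m (A : 'M[S]_(m, n.+1)) i (k : 'I_n) :
  (A *m edge_mx S n B) i k =
  A i (inord (branch B k).1.2) - A i (inord (branch B k).1.1).
Proof.
have [c1 c2] := branch_edge_bounds k.
have sel c : (c < n.+1)%N -> \sum_j A i j * (j == c :> nat)%:R = A i (inord c).
  move=> cn; rewrite (bigD1 (inord c)) //= inordK // eqxx mulr1.
  rewrite big1 ?addr0 // => j jc.
  rewrite (_ : (j == c :> nat) = false) ?mulr0 //; apply/negbTE.
  by apply: contraNneq jc => <-; rewrite inord_val.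
rewrite mxE -!sel // -sumrB; apply: eq_bigr => j _.
by rewrite !mxE mulrBr.
Qed.

Lemma mul_root_col (S : nzRingType) m (A : 'M[S]_(m, n.+1)) i :
  (A *m root_col S n B) i 0 = A i (inord (root_label 0 B)).
Proof.
have rn := root_label_lt.
rewrite mxE (bigD1 (inord (root_label 0 B))) //= mxE inordK // eqxx mulr1.
rewrite big1 ?addr0 // => j jc.
rewrite mxE (_ : (j == _ :> nat) = false) ?mulr0 //; apply/negbTE.
by apply: contraNneq jc => <-; rewrite inord_val.
Qed.

Lemma tree_orderedP (R : realDomainType) (v : 'rV[R]_n.+1) :
  ordered 0 B (fun j => v 0 (inord j)) <->
  forall k, 0 <= (v *m edge_mx R n B) 0 k.
Proof.
split=> [/allP o k|o].
  by rewrite mul_edge_mx subr_ge0; apply: o; apply: branch_edge_mem.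
apply/allP => e /edge_branchP[k ->].
by have := o k; rewrite mul_edge_mx subr_ge0.
Qed.

Lemma in_branch_root (k : 'I_n) : in_branch B k (root_label 0 B) = false.
Proof.
have [_ _ /matrixP/(_ k 0) + _] := tree_dual_basis int.
by rewrite mul_root_col !mxE inordK ?root_label_lt // => /eqP; case: in_branch.
Qed.

(** An entry of the duality between branches and edges: only its own edge crosses the border of a
    branch. *)
Lemma in_branch_edge (k l : 'I_n) :
  (in_branch B k (branch B l).1.2)%:R - (in_branch B k (branch B l).1.1)%:R =
  (k == l)%:R :> int.
Proof.
have [c1 c2] := branch_edge_bounds l.
have [_ _ _ /matrixP/(_ k l)] := tree_dual_basis int.
by rewrite mul_edge_mx !mxE !inordK.
Qed.

Lemma branch_edge_inj (k l : 'I_n) : (branch B k).1 = (branch B l).1 -> k = l.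
Proof.
move=> kl; have := in_branch_edge k l; rewrite -kl in_branch_edge eqxx.
by case: eqP.
Qed.

(** Translates the component defined by connectivity into an interval of labels. *)
Lemma in_lower_part (k : 'I_n) (j : 'I_n.+1) :
  (j \in lower_part n.+1 B (branch B k).1) = in_branch B k j.
Proof.
pose rt : 'I_n.+1 := Ordinal root_label_lt.
set e := (branch B k).1; pose adj := @adj_without B e n.+1.
have adj_sym : connect_sym adj.
  by apply: sym_connect_sym => x y; rewrite /adj /adj_without orbC.
have -> : (j \in lower_part n.+1 B e) = ~~ connect adj rt j.
  rewrite inE; congr (~~ _); apply/existsP/idP => [[r /andP[/eqP rE]]|c].
    by have -> : r = rt by apply: val_inj.
  by exists rt; rewrite eqxx.
apply/idP/idP => [|jk].
  (* The indicator v of the nodes not connected to the root is constant along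
     the remaining edges, so it is a multiple of that of the branch. *)
  apply: contraNT => jk.
  pose v (l : nat) : int := (~~ connect adj rt (inord l))%:R.
  have v0 : v j = 0.
    rewrite (branch_expansion v) big1 ?addr0 => [|l _].
      rewrite /v (_ : inord _ = rt) ?connect0 //; apply: val_inj.
      by rewrite /= inordK ?root_label_lt.
    have [->|lk] := eqVneq l k; first by rewrite (negbTE jk) mulr0.
    rewrite (_ : _ - _ = 0) ?mul0r //; apply/eqP; rewrite subr_eq0; apply/eqP.
    congr ((~~ _)%:R); rewrite !(adj_sym rt); apply: same_connect => //.
    have [c1 c2] := branch_edge_bounds l.
    apply: connect1; rewrite /adj /adj_without /= !inordK // !mem_filter.
    rewrite -surjective_pairing branch_edge_mem andbT orbC.
    have -> : ((branch B l).1 != e) by apply: contra_neq lk => /branch_edge_inj.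
    by [].
  by move: v0; rewrite /v inord_val; case: connect.
apply/negP => c.
(* Conversely, the remaining edges do not leave the branch, and the root is outside it. *)
have cl : fingraph.closed adj [pred i : 'I_n.+1 | in_branch B k i].
  have adjL (x y : 'I_n.+1) : (val x, val y) \in [seq f <- edges B | f != e] ->
      in_branch B k x = in_branch B k y.
    rewrite mem_filter => /andP[fe /edge_branchP[l lE]].
    have kl : (k == l) = false.
      by apply/negbTE; apply: contra_neq fe => kl; rewrite lE /e kl.
    have := in_branch_edge k l; rewrite kl -lE /=.
    by do 2!case: in_branch.
  by move=> x y /orP[] /adjL xy; rewrite !inE xy.
have := closed_connect cl c; rewrite !inE.
by rewrite jk in_branch_root.
Qed.

End TreeMatrices.

(** * The dual cone of the associahedron *)

Local Open Scope classical_set_scope.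
Local Open Scope ring_scope.

Section IntervalMin.
Context {R : realType} {n : nat}.
Implicit Types (v w : 'rV[R]_n.+1) (p : interval_idx n.+1) (k : 'I_n.+1).

Local Notation "k \inI p" :=
  ((val p).1 <= (k : 'I_n.+1) <= (val p).2)%N (at level 70).

(** Since [support_fun] is minus an infimum, this is the least coordinate of [v] on the interval. *)
Definition interval_min p v : R := - support_fun (Delta p) v.

Lemma dotv_sumr (I : finType) (A : pred I) v (y : I -> 'rV[R]_n.+1) :
  dotv v (\sum_(i | A i) y i) = \sum_(i | A i) dotv v (y i).
Proof.
rewrite /dotv exchange_big /=; apply: eq_bigr => k _.
by rewrite summxE mulr_sumr.
Qed.

Lemma dotvZr v a y : dotv v (a *: y) = a * dotv v y.
Proof.
by rewrite /dotv mulr_sumr; apply: eq_bigr => k _; rewrite !mxE mulrCA.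
Qed.

Lemma dotv_delta v k : dotv v (delta_mx 0 k) = v 0 k.
Proof.
rewrite /dotv (bigD1 k) //= big1 => [|l lk].
  by rewrite mxE !eqxx mulr1 addr0.
by rewrite mxE (negbTE lk) andbF mulr0.
Qed.

Lemma Delta_delta p k : k \inI p -> Delta p (delta_mx 0 k : 'rV[R]_n.+1).
Proof.
move=> kp; exists (fun l => (l == k)%:R).
  split=> [l|]; first exact: ler0n.
  rewrite (bigD1 k) ?inE //= eqxx big1 ?addr0 // => l /andP[_ lk].
  by rewrite (negbTE lk).
rewrite (bigD1 k) ?inE //= eqxx scale1r big1 ?addr0 // => l /andP[_ lk].
by rewrite (negbTE lk) scale0r.
Qed.

Lemma interval_minE p v k : k \inI p ->
  (forall l : 'I_n.+1, l \inI p -> v 0 k <= v 0 l) -> interval_min p v = v 0 k.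
Proof.
move=> kp vk; rewrite /interval_min /support_fun opprK.
have lb : lbound [set dotv v y | y in Delta p] (v 0 k).
  move=> _ [y [a [a0 a1] ->] <-]; rewrite dotv_sumr.
  rewrite -[leLHS]mul1r -a1 mulr_suml; apply: ler_sum => l; rewrite inE => lp.
  by rewrite dotvZr dotv_delta ler_wpM2l //; apply: vk.
have inD : [set dotv v y | y in Delta p] (v 0 k).
  by exists (delta_mx 0 k); [exact: Delta_delta|exact: dotv_delta].
apply/le_anti/andP; split; last by apply: lb_le_inf => //; exists (v 0 k).
by apply: ge_inf => //; exists (v 0 k).
Qed.

Lemma interval_argmin p v : exists2 k, k \inI p &
  forall l : 'I_n.+1, l \inI p -> v 0 k <= v 0 l.
Proof.
have p1 : (val p).1 \inI p by rewrite leqnn /=; exact: (valP p).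
have [k kp vk] := @arg_minP _ _ _ (val p).1 (fun k : 'I_n.+1 => k \inI p)
  (fun k => v 0 k) p1.
by exists k.
Qed.

Lemma interval_min_attained p v :
  exists2 k, k \inI p & interval_min p v = v 0 k.
Proof.
by have [k kp vk] := interval_argmin p v; exists k => //; apply: interval_minE.
Qed.

Lemma interval_min_le p v k : k \inI p -> interval_min p v <= v 0 k.
Proof.
move=> kp; have [l lp vl] := interval_argmin p v.
by rewrite (interval_minE lp vl); apply: vl.
Qed.

Lemma interval_minDc p v c :
  interval_min p (v + const_mx c) = interval_min p v + c.
Proof.
have [k kp vk] := interval_min_attained p v.
rewrite (@interval_minE _ _ k) ?mxE ?vk // => l lp.
by rewrite !mxE lerD2r -vk interval_min_le.
Qed.

(** Concavity: where the combination attains its minimum, each [w i] is at least its own minimum. *)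
Lemma interval_min_sum (I : finType) p (a : I -> R) (w : I -> 'rV[R]_n.+1) :
  (forall i, 0 <= a i) ->
  \sum_i a i * interval_min p (w i) <= interval_min p (\sum_i a i *: w i).
Proof.
move=> a0; have [k kp ->] := interval_min_attained p (\sum_i a i *: w i).
rewrite summxE; apply: ler_sum => i _; rewrite mxE ler_wpM2l //.
exact: interval_min_le.
Qed.

(** The function H, which is also the minimum of [dotv v] on the Minkowski sum. *)
Definition total_min v : R := \sum_p interval_min p v.

Lemma total_minDc v c :
  total_min (v + const_mx c) = total_min v + c *+ #|{: interval_idx n.+1}|.
Proof.
rewrite /total_min (eq_bigr (fun p => interval_min p v + c)) => [|p _].
  by rewrite big_split sumr_const.
exact: interval_minDc.
Qed.

Lemma card_interval_idx_gt0 : (0 < #|{: interval_idx n.+1}|)%N.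
Proof.
by apply/card_gt0P; exists (exist _ (ord0, ord0) (leqnn 0)).
Qed.

(** A Lipschitz bound: [v] lies below [w] raised by [e], and every interval minimum is monotone. *)
Lemma total_min_perturb v w e : (forall k, `|v 0 k - w 0 k| < e) ->
  total_min v - e *+ #|{: interval_idx n.+1}| <= total_min w.
Proof.
move=> vw; rewrite lerBlDr -total_minDc; apply: ler_sum => p _.
rewrite interval_minDc; have [k kp ->] := interval_min_attained p w.
apply: le_trans (interval_min_le v kp) _.
by have := ltW (vw k); rewrite ler_norml; lra.
Qed.

(** Choosing in each [Delta p] a vertex at which [v] is least gives a point of the Minkowski sum
    where [dotv v] equals [total_min v]. *)
Lemma dual_coneE v :
  dual_cone (cone_over (minkowski_sum (@Delta R n))) v <-> 0 <= total_min v.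
Proof.
split=> [vC|v0 _ [t [y [t0 [f fD ->] ->]]]].
  have /choice[m mP] p : exists k, k \inI p /\ interval_min p v = v 0 k.
    by have [k] := interval_min_attained p v; exists k.
  have := vC (\sum_p delta_mx 0 (m p)).
  rewrite dotv_sumr (eq_bigr (fun p => interval_min p v)) => [|p _]; last first.
    by rewrite dotv_delta (mP p).2.
  apply; exists 1, (\sum_p delta_mx 0 (m p)); split; rewrite ?scale1r //.
  exists (fun p => delta_mx 0 (m p)) => // p.
  by apply: Delta_delta; exact: (mP p).1.
rewrite dotvZr mulr_ge0 // dotv_sumr; apply: le_trans v0 _.
apply: ler_sum => p _; have [a [a0 a1] ->] := fD p.
rewrite dotv_sumr -[leLHS]mul1r -a1 mulr_suml.
apply: ler_sum => l; rewrite inE => lp.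
by rewrite dotvZr dotv_delta ler_wpM2l //; apply: interval_min_le.
Qed.

(** By continuity [total_min] is nonnegative on the closure and cannot be positive off the
    interior. *)
Lemma boundaryE v :
  boundary (dual_cone (cone_over (minkowski_sum (@Delta R n)))) v <->
  total_min v = 0.
Proof.
set C := dual_cone _; pose N := #|{: interval_idx n.+1}|%:R : R.
have N0 : 0 < N by rewrite ltr0n card_interval_idx_gt0.
have near w e : 0 < e -> \forall u \near w, total_min w - e * N <= total_min u
     /\ total_min u - e * N <= total_min w.
  move=> e0; apply/nbhs_ballP; exists e => // u [_ wu].
  rewrite /N !mulr_natr; split; apply: total_min_perturb => k.
    by have := wu 0 k.
  by have := wu 0 k; rewrite /ball /= distrC.
split=> [[clC nintC]|v0].
  apply/eqP; rewrite eq_le; apply/andP; split; rewrite leNgt; apply/negP => v0.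
    apply: nintC; have e0 : 0 < total_min v / N by rewrite divr_gt0.
    apply: filterS (near v _ e0) => u [+ _]; rewrite mulfVK ?gt_eqF // subrr.
    by move=> ?; apply/dual_coneE.
  have e0 : 0 < - total_min v / N / 2 by rewrite !divr_gt0 // oppr_gt0.
  have [u [/dual_coneE u0 [_ uv]]] := clC _ (near v _ e0).
  suff : - total_min v / N / 2 * N = - total_min v / 2 by lra.
  by field; rewrite gt_eqF.
split; first by apply: subset_closure; apply/dual_coneE; rewrite v0.
move=> /nbhs_ballP[e /= e0 eC].
(* Lowering all coordinates by half the radius stays in the ball but makes [total_min] negative. *)
have /dual_coneE : C (v + const_mx (- (e / 2))).
  apply: eC; split=> // i j; rewrite /ball /= !mxE.
  by rewrite opprD addrA subrr add0r opprK gtr0_norm ?divr_gt0 //; lra.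
rewrite total_minDc v0 add0r mulNrn oppr_ge0 -[_ *+ #|_|]mulr_natr.
by rewrite leNgt => /negP; apply; rewrite mulr_gt0 ?divr_gt0.
Qed.

End IntervalMin.

(** * The forms in the denominators *)

Section Forms.
Context {R : realType} {n : nat}.
Implicit Types (v w : 'rV[R]_n.+1) (p : interval_idx n.+1).
Implicit Types (x : interval_idx n.+1 -> R).

Lemma dmv_formE x v :
  dmv_form (@Delta R n) x 0 v = - \sum_p x p * interval_min p v.
Proof.
rewrite /dmv_form /dotv [X in _ + X]big1 => [|k _]; last by rewrite mxE mulr0.
rewrite addr0.
by rewrite -sumrN; apply: eq_bigr => p _; rewrite /interval_min mulrN opprK.
Qed.

Lemma interval_minZ p v a :
  0 <= a -> interval_min p (a *: v) = a * interval_min p v.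
Proof.
move=> a0; have [k kp vk] := interval_min_attained p v.
rewrite (@interval_minE _ _ _ _ k) // => [|l lp]; rewrite !mxE ?vk //.
by rewrite ler_wpM2l // -vk interval_min_le.
Qed.

(** Adding [b] to all coordinates changes the form by [- b] times the sum of [x], which is 0. *)
Lemma dmv_form_affine x v a b : \sum_p x p = 0 -> 0 <= a ->
  dmv_form (@Delta R n) x 0 (a *: v + const_mx b) =
  a * dmv_form (@Delta R n) x 0 v.
Proof.
move=> x0 a0; rewrite !dmv_formE mulrN; congr (- _).
rewrite (eq_bigr (fun p => a * (x p * interval_min p v) + x p * b)) => [|p _].
  by rewrite big_split /= -mulr_sumr -mulr_suml x0 mul0r addr0.
by rewrite interval_minDc interval_minZ //; ring.
Qed.

(* On the cone of a tree each interval minimum is attained at a fixed node. *)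
Lemma dmv_form_linear x B : nnodes B = n.+1 ->
  exists f : 'cV[R]_n.+1, const_mx 1 *m f = (- \sum_p x p)%:M /\
    forall v, ordered 0 B (fun j => v 0 (inord j)) ->
      dmv_form (@Delta R n) x 0 v = (v *m f) 0 0.
Proof.
move=> nB.
have /choice[m mP] p : exists m : 'I_n.+1,
    forall v, ordered 0 B (fun j => v 0 (inord j)) -> interval_min p v = v 0 m.
  have [//||m mp H] := @ordered_argmin R 0 B (val p).1 (val p).2 _ (valP p).
    by rewrite nB.
  have mn : (m < n.+1)%N by have := ltn_ord (val p).2; lia.
  exists (inord m) => v o; apply: interval_minE; first by rewrite inordK.
  by move=> l lp; have := H _ o l lp; rewrite inord_val.
exists (\sum_p - x p *: delta_mx (m p) 0); split=> [|v o].
  rewrite mulmx_sumr -sumrN raddf_sum /=; apply: eq_bigr => p _.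
  by rewrite -scalemxAr -colE; apply/matrixP => i j; rewrite !ord1 !mxE mulr1.
rewrite dmv_formE -sumrN mulmx_sumr summxE; apply: eq_bigr => p _.
by rewrite (mP p v o) -scalemxAr -colE !mxE mulNr.
Qed.

(** Makes [total_min] an instance of the form, so that [dmv_form_linear] applies to it. *)
Lemma total_minE v : total_min v = dmv_form (@Delta R n) (fun=> -1) 0 v.
Proof.
by rewrite dmv_formE -sumrN; apply: eq_bigr => p _; rewrite mulN1r opprK.
Qed.

End Forms.

Section Branches.
Context {R : realType} {n : nat}.
Variable B : pbtree.
Hypothesis nB : nnodes B = n.+1.
Implicit Types (p : interval_idx n.+1) (x : interval_idx n.+1 -> R) (k : 'I_n).

Lemma branch_ordered k :
  ordered 0 B (fun j => row k (branch_mx R n B) 0 (inord j)).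
Proof.
apply/(tree_orderedP nB) => l; rewrite -row_mul.
have [_ _ _ ->] := tree_dual_basis nB R.
by rewrite !mxE ler0n.
Qed.

Lemma in_branch_convex k i j l : in_branch B k i -> in_branch B k j ->
  (i <= l <= j)%N -> in_branch B k l.
Proof. by rewrite /in_branch; case: (branch B k) => _ [lo hi] /=; lia. Qed.

(** The indicator of a label interval has minimum 1 on [i, j] when both ends belong to it, and 0
    otherwise. *)
Lemma dmv_form_branch x k :
  dmv_form (@Delta R n) x 0 (row k (branch_mx R n B)) =
  - \sum_(p | ((val p).1 \in lower_part n.+1 B (branch B k).1) &&
              ((val p).2 \in lower_part n.+1 B (branch B k).1)) x p.
Proof.
rewrite dmv_formE; congr (- _); rewrite [RHS]big_mkcond; apply: eq_bigr => p _.
rewrite !(in_lower_part nB) /=; have ij : ((val p).1 <= (val p).2)%N := valP p.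
have vE l : row k (branch_mx R n B) 0 l = (in_branch B k l)%:R by rewrite !mxE.
case: ifP => [/andP[iL jL]|/negbT].
  rewrite (@interval_minE _ _ _ _ (val p).1) ?leqnn // => [|l lp].
    by rewrite vE iL mulr1.
  rewrite !vE iL.
  by rewrite (in_branch_convex iL jL lp).
rewrite negb_and => /orP[/negbTE iL|/negbTE jL].
  rewrite (@interval_minE _ _ _ _ (val p).1) ?leqnn // => [|l lp];
    by rewrite !vE iL ?mulr0 ?ler_nat.
rewrite (@interval_minE _ _ _ _ (val p).2) ?leqnn ?andbT // => [|l lp];
  by rewrite !vE jL ?mulr0 ?ler_nat.
Qed.

Lemma prod_dmv_form_branch x :
  (\prod_k dmv_form (@Delta R n) x 0 (row k (branch_mx R n B)))^-1 =
  (-1) ^+ n * \prod_(e <- edges B)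
     (\sum_(p : interval_idx n.+1 | ((val p).1 \in lower_part n.+1 B e) &&
                                    ((val p).2 \in lower_part n.+1 B e)) x p)^-1.
Proof.
rewrite /edges edges_from_branches big_map (big_nth ((0, 0), (0, 0))%N).
rewrite (size_edge_branches nB) big_mkord.
rewrite (eq_bigr _ (fun k _ => dmv_form_branch x k)) prodrN card_ord.
by rewrite invfM -exprVn invrN1 prodfV.
Qed.
End Branches.

(** * Triangulations of the boundary *)

Section Triangulation.
Context {R : realType} {n : nat} (T : seq 'M[R]_(n, n.+1)).
Hypothesis hT : is_dmv_triangulation (@Delta R n) T.
Implicit Types (v w : 'rV[R]_n.+1) (p : interval_idx n.+1).
Implicit Types (x : interval_idx n.+1 -> R).
Implicit Types (V W : 'M[R]_(n, n.+1)).

Lemma cone_spanP V v :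
  cone_span V v <-> exists2 a : 'rV[R]_n, (forall k, 0 <= a 0 k) & v = a *m V.
Proof.
split=> [[a a0 ->]|[a a0 ->]].
  exists (\row_k a k) => [k|]; first by rewrite mxE.
  by rewrite mulmx_sum_row; apply: eq_big => [k|k _]; rewrite ?inE ?mxE.
exists (fun k => a 0 k) => //; rewrite mulmx_sum_row.
by apply: eq_bigl => k; rewrite inE.
Qed.

Lemma cone_span_row V k : cone_span V (row k V).
Proof.
apply/cone_spanP; exists (delta_mx 0 k); last by rewrite -rowE.
by move=> m; rewrite mxE ler0n.
Qed.

Lemma cone_total_min V v : V \in T -> cone_span V v -> total_min v = 0.
Proof.
move=> VT Vv; case: hT => _ _ bd _; apply/boundaryE.
by rewrite /boundary -/(boundary _) -bd; exists V.
Qed.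

Lemma cone_cover v : total_min v = 0 -> exists2 V, V \in T & cone_span V v.
Proof.
move=> /boundaryE; case: hT => _ _ <- _ [V VT Vv]; by exists V.
Qed.

(** Equality case of concavity: the defects [d q] are nonnegative and sum to 0 as [total_min]
    vanishes on the cone. So a position of the minimum for a combination is one for every generator
    with positive weight. *)
Lemma interval_min_cone V p (a : 'rV[R]_n) i l : V \in T ->
  (forall k, 0 <= a 0 k) -> interval_min p (a *m V) = (a *m V) 0 i ->
  ((val p).1 <= i <= (val p).2)%N -> 0 < a 0 l ->
  interval_min p (row l V) = V l i.
Proof.
move=> VT a0 ai ip al.
pose d q := interval_min q (a *m V) - \sum_k a 0 k * interval_min q (row k V).
have d_ge0 q : 0 <= d q.
  by rewrite subr_ge0 mulmx_sum_row; apply: interval_min_sum.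
have tm k := cone_total_min VT (cone_span_row V k).
have : \sum_q d q = 0.
  have aV : cone_span V (a *m V) by apply/cone_spanP; exists a.
  rewrite sumrB -/(total_min _) (cone_total_min VT aV).
  rewrite exchange_big /= big1 ?subr0 // => k _.
  by rewrite -mulr_sumr -/(total_min _) tm mulr0.
move/psumr_eq0P => /(_ (fun q _ => d_ge0 q) p isT)/eqP.
rewrite subr_eq0 ai mxE => /eqP aE.
have t_ge0 k : 0 <= a 0 k * V k i - a 0 k * interval_min p (row k V).
  rewrite -mulrBr mulr_ge0 // subr_ge0.
  by have := interval_min_le (row k V) ip; rewrite mxE.
have : \sum_k (a 0 k * V k i - a 0 k * interval_min p (row k V)) = 0.
  by rewrite sumrB aE subrr.
move/psumr_eq0P => /(_ (fun k _ => t_ge0 k) l isT)/eqP.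
by rewrite -mulrBr mulf_eq0 gt_eqF //= subr_eq0 => /eqP ->.
Qed.

(** [B] is a tree ordered by the sum of the generators. Between the ends of an edge this sum is
    least at the parent, hence so is every generator. *)
Lemma cone_tree V : V \in T -> exists B, nnodes B = n.+1 /\
  forall v, cone_span V v -> ordered 0 B (fun j => v 0 (inord j)).
Proof.
move=> VT; pose a : 'rV[R]_n := const_mx 1.
have [B nB oB] := exists_ordered (fun j => (a *m V) 0 (inord j)) 0 n.+1.
exists B; split=> // v /cone_spanP[b b0 ->].
suff H (e : nat * nat) : e \in edges_from 0 B ->
    (b *m V) 0 (inord e.1) <= (b *m V) 0 (inord e.2) by apply/allP.
move=> eB.
have := edges_from_bounds eB; rewrite nB => -[/= e1 e2].
have q1 : (minn e.1 e.2 < n.+1)%N by lia.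
have q2 : (maxn e.1 e.2 < n.+1)%N by lia.
have q12 : (Ordinal q1 <= Ordinal q2)%N by rewrite /=; lia.
pose q : interval_idx n.+1 := exist _ (Ordinal q1, Ordinal q2) q12.
have e1q : ((val q).1 <= (inord e.1 : 'I_n.+1) <= (val q).2)%N.
  by rewrite inordK /=; lia.
have e2q : ((val q).1 <= (inord e.2 : 'I_n.+1) <= (val q).2)%N.
  by rewrite inordK /=; lia.
have minq : interval_min q (a *m V) = (a *m V) 0 (inord e.1).
  apply: interval_minE => // l lq.
  by have := ordered_edge_min oB eB lq; rewrite inord_val.
rewrite !mxE; apply: ler_sum => k _; rewrite ler_wpM2l //.
rewrite -(interval_min_cone (l := k) VT _ minq e1q) => [|m|]; rewrite ?mxE //.
by have := interval_min_le (row k V) e2q; rewrite mxE.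
Qed.

Lemma edge_mx_kernel B v : nnodes B = n.+1 -> v *m edge_mx R n B = 0 ->
  v = const_mx ((v *m root_col R n B) 0 0).
Proof.
move=> nB vE.
rewrite -[LHS]mulmx1 -(tree_basis nB) mulmxDr !mulmxA vE mul0mx addr0.
rewrite [X in X *m _]mx11_scalar mul_scalar_mx.
by apply/matrixP => i j; rewrite !mxE mulr1.
Qed.

(** Two points with equal edge increments differ by a constant vector, and [total_min] detects the
    constant. *)
Lemma cone_inj V v w : V \in T -> cone_span V v -> total_min w = 0 ->
  forall B, nnodes B = n.+1 -> (v - w) *m edge_mx R n B = 0 -> v = w.
Proof.
move=> VT /(cone_total_min VT) v0 w0 B nB /(edge_mx_kernel nB).
move: (X in const_mx X) => c vw; have vE : v = w + const_mx c.
  by rewrite -vw addrC subrK.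
move: v0; rewrite vE total_minDc w0 add0r => /eqP; rewrite mulrn_eq0.
rewrite eqn0Ngt card_interval_idx_gt0 /= => /eqP ->.
by apply/matrixP => i j; rewrite !mxE addr0.
Qed.

(** On the cone of [B] the function [total_min] is a linear form [f], which vanishes on the rows of
    [V] but not at (1, ..., 1). So no nonzero combination of the rows is constant. *)
Lemma cone_proj_unit V B : V \in T -> nnodes B = n.+1 ->
  (forall v, cone_span V v -> ordered 0 B (fun j => v 0 (inord j))) ->
  V *m edge_mx R n B \in unitmx.
Proof.
move=> VT nB oV; rewrite -row_free_unit; apply: inj_row_free => w.
rewrite mulmxA => /(edge_mx_kernel nB); move: (X in const_mx X) => c wV.
have [f [f1 fP]] := @dmv_form_linear R n (fun=> -1) B nB.
have Vf : V *m f = 0.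
  apply/matrixP => k j; rewrite !ord1 [RHS]mxE.
  have rV := cone_span_row V k.
  have := cone_total_min VT rV; rewrite total_minE fP; last exact: oV.
  by rewrite -row_mul mxE => ->.
have /matrixP/(_ 0 0) : w *m V *m f = 0 by rewrite -mulmxA Vf mulmx0.
have -> : w *m V = c *: const_mx 1.
  by rewrite wV; apply/matrixP => i j; rewrite !mxE mulr1.
rewrite -scalemxAl f1 !mxE eqxx mulr1n sumrN opprK sumr_const => /eqP.
rewrite mulf_eq0 pnatr_eq0 eqn0Ngt card_interval_idx_gt0 orbF => /eqP c0.
have [free _ _ _] := hT; have /row_free_inj/(_ w 0) := free V VT.
apply; rewrite mul0mx wV c0; apply/matrixP => i j; rewrite !mxE //.
Qed.


(* The point of the boundary above the class of [v] modulo (1, ..., 1). *)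
Definition tight v : 'rV[R]_n.+1 :=
  v + const_mx (- (total_min v / #|{: interval_idx n.+1}|%:R)).

Lemma total_min_tight v : total_min (tight v) = 0.
Proof.
rewrite /tight total_minDc mulNrn -[_ *+ #|_|]mulr_natr mulfVK ?subrr //.
by rewrite pnatr_eq0 -lt0n card_interval_idx_gt0.
Qed.

Lemma tight_edge_mx v B :
  nnodes B = n.+1 -> tight v *m edge_mx R n B = v *m edge_mx R n B.
Proof.
move=> nB; have [_ E0 _ _] := tree_dual_basis nB R.
rewrite /tight mulmxDl; move: (- (_ / _)) => a.
rewrite (_ : const_mx _ = a *: const_mx 1).
  by rewrite -scalemxAl E0 scaler0 addr0.
by apply/matrixP => i j; rewrite !mxE mulr1.
Qed.

(* A ray of the normal fan is a ray of every triangulation. *)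
Lemma dmv_form_branch_neq0 x B (k : 'I_n) : nnodes B = n.+1 ->
  \sum_p x p = 0 -> dmv_regular (@Delta R n) T x 0 ->
  dmv_form (@Delta R n) x 0 (row k (branch_mx R n B)) != 0.
Proof.
move=> nB x0 reg; set g := row k _; set v := tight g.
have gE i : g 0 i = (in_branch B k i)%:R by rewrite !mxE.
have vE i : v 0 i = (in_branch B k i)%:R + v 0 (inord (root_label 0 B)).
  rewrite /v /tight !mxE inordK ?root_label_lt // in_branch_root // add0r.
  by [].
have tv : total_min v = 0 by exact: total_min_tight.
have [V VT /cone_spanP[a a0 vV]] := cone_cover tv.
have [_ _ _ GE] := tree_dual_basis nB R.
(* A generator with positive weight in [v]; it turns out to be a multiple of [g] modulo (1, ...,
   1). *)
have [l al] : exists l, 0 < a 0 l.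
  apply/existsP; apply: contraT => /existsPn al.
  have a00 : a = 0.
    apply/matrixP => i j; rewrite ord1 mxE; apply/eqP; rewrite eq_le a0 andbT.
    by rewrite leNgt al.
  have : v *m edge_mx R n B = 0 by rewrite vV a00 !mul0mx.
  rewrite tight_edge_mx // -row_mul GE => /matrixP/(_ 0 k)/eqP.
  by rewrite !mxE eqxx oner_eq0.
pose c := (branch B k).1.2.
have [_ cn] := branch_edge_bounds nB k.
have ck : in_branch B k c.
  by have := in_branch_edge nB k k; rewrite eqxx /c; do 2!case: in_branch.
have [lo_hi hin] :
    ((branch B k).2.1 < (branch B k).2.2)%N /\ ((branch B k).2.2 <= n.+1)%N.
  split; first by move: ck; rewrite /in_branch; lia.
  have kE : branch B k \in edge_branches 0 B.
    by apply: mem_nth; rewrite (size_edge_branches nB).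
  by have := branch_bounds kE; rewrite nB; lia.
have q1 : ((branch B k).2.1 < n.+1)%N by lia.
have q2 : ((branch B k).2.2.-1 < n.+1)%N by lia.
have q12 : (Ordinal q1 <= Ordinal q2)%N by rewrite /=; lia.
(* [q] is the label interval of the branch and [p] the interval of all labels. On [p], [v] is least
   at every node outside the branch; on [q] it is constant. *)
pose q : interval_idx n.+1 := exist _ (Ordinal q1, Ordinal q2) q12.
pose p : interval_idx n.+1 := exist _ (ord0, ord_max) (leq0n _).
have inq (i : 'I_n.+1) : ((val q).1 <= i <= (val q).2)%N = in_branch B k i.
  by rewrite /= /in_branch; lia.
have inp (i : 'I_n.+1) : ((val p).1 <= i <= (val p).2)%N.
  by rewrite /= -ltnS ltn_ord.
pose b1 := interval_min p (row l V); pose b2 := interval_min q (row l V).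
have out (i : 'I_n.+1) : ~~ in_branch B k i -> V l i = b1.
  move=> ik; apply/esym/(interval_min_cone VT a0 _ (inp i) al); rewrite -vV.
  apply: interval_minE => // j _; rewrite (vE i) (vE j) (negbTE ik) lerD2r.
  exact: ler0n.
have inn (i : 'I_n.+1) : in_branch B k i -> V l i = b2.
  move=> ik; have iq := ik; rewrite -inq in iq.
  apply/esym/(interval_min_cone VT a0 _ iq al); rewrite -vV.
  by apply: interval_minE => // j; rewrite inq (vE i) (vE j) ik => ->.
have b12 : b1 <= b2.
  have <- : V l (inord c) = b2 by apply: inn; rewrite inordK.
  by have := interval_min_le (row l V) (inp (inord c)); rewrite mxE.
have rowE : row l V = (b2 - b1) *: g + const_mx b1.
  apply/matrixP => i j.
  rewrite ord1 mxE [RHS]mxE [X in X + _]mxE gE [X in _ + X]mxE.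
  have [jk|jk] := boolP (in_branch B k j); first by rewrite inn // mulr1 subrK.
  by rewrite out // mulr0 add0r.
have := reg V VT l; rewrite rowE dmv_form_affine ?subr_ge0 //.
by rewrite mulf_eq0 negb_or => /andP[].
Qed.

(** The product with [row_mx root_col edge_mx], of determinant +-1, is block triangular with corner
    1. *)
Lemma norm_det_proj V B : nnodes B = n.+1 ->
  `|\det (V *m edge_mx R n B)| =
  `|\det (col_mx (const_mx 1 : 'rV[R]_n.+1) V : 'M[R]_n.+1)|.
Proof.
move=> nB; have [one E0 _ _] := tree_dual_basis nB R.
rewrite -[RHS]mulr1 -[X in _ = _ * X](norm_det_tree nB R) -normrM -det_mulmx.
rewrite (@mul_col_row _ 1 n n.+1 1 n) one E0.
by rewrite [in RHS](@det_lblock _ 1 n) det1 mul1r.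
Qed.

Section TreeCone.
Variables (B : pbtree) (y : 'rV[R]_n).
Hypothesis nB : nnodes B = n.+1.
(** The boundary point whose increments along the edges of [B] are [y]. *)
Let xi := tight (y *m branch_mx R n B).

Lemma xi_edge : xi *m edge_mx R n B = y.
Proof.
rewrite tight_edge_mx // -mulmxA.
by have [_ _ _ ->] := tree_dual_basis nB R; rewrite mulmx1.
Qed.

Lemma in_cone_span V : V \in T ->
  (forall v, cone_span V v -> ordered 0 B (fun j => v 0 (inord j))) ->
  in_cone (V *m edge_mx R n B) y <-> cone_span V xi.
Proof.
move=> VT oV; have VU := cone_proj_unit VT nB oV.
split=> [/forallP y0|/cone_spanP[b b0 xib]].
  have bV : cone_span V (y *m invmx (V *m edge_mx R n B) *m V).
    by apply/cone_spanP; exists (y *m invmx (V *m edge_mx R n B)).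
  have <- // : y *m invmx (V *m edge_mx R n B) *m V = xi.
  apply: (cone_inj VT bV (total_min_tight _) nB); rewrite mulmxBl xi_edge.
  by rewrite -(mulmxA _ V) mulmxKV // subrr.
by apply/forallP => k; rewrite -xi_edge xib -(mulmxA _ V) mulmxK.
Qed.

Lemma in_cone_ordered :
  in_cone 1%:M y <-> ordered 0 B (fun j => xi 0 (inord j)).
Proof.
rewrite /in_cone invmx1 mulmx1 (tree_orderedP nB) xi_edge.
by split=> [/forallP|H]; last apply/forallP.
Qed.

(** For generic [y] all coordinates in the basis [V] are nonzero, so [xi] lies on no proper face. *)
Lemma cone_face_full V (S : {set 'I_n}) : V *m edge_mx R n B \in unitmx ->
  (forall k, (y *m col k (invmx (V *m edge_mx R n B))) 0 0 != 0) ->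
  cone_face V S xi -> S = [set: 'I_n]%SET.
Proof.
move=> VU gen [a a0 xiE]; apply/setP => k; rewrite inE; apply/negPn/negP => kS.
case/eqP: (gen k); rewrite colE mulmxA -colE.
pose b : 'rV[R]_n := \row_j if j \in S then a j else 0.
have xib : xi = b *m V.
  rewrite xiE mulmx_sum_row [LHS]big_mkcond; apply: eq_bigr => j _; rewrite mxE.
  by case: ifP; rewrite ?scale0r.
rewrite -[in LHS]xi_edge xib -(mulmxA _ V) mulmxK //.
by rewrite !mxE (negbTE kS).
Qed.

(** The form [h] computes the difference of coordinates [i] and [j] of [xi]; it is nonzero for
    distinct [i], [j], so a generic [y] separates them. *)
Lemma xi_inj :
  (forall i j, let h := branch_mx R n B *m (delta_mx i 0 - delta_mx j 0) in
    h != 0 :> 'cV[R]_n -> (y *m h) 0 0 != 0) ->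
  forall i j, xi 0 i = xi 0 j -> i = j.
Proof.
move=> gen i j xij; apply/eqP; apply: contraT => ij.
have d0 : (const_mx 1 : 'rV[R]_n.+1) *m (delta_mx i 0 - delta_mx j 0) =
    0 :> 'M_1.
  by rewrite mulmxBr -!colE; apply/matrixP => ? ?; rewrite !mxE subrr.
have G0 : branch_mx R n B *m (delta_mx i 0 - delta_mx j 0 : 'cV[R]_n.+1) = 0.
  apply/eqP; apply: contraT => /gen/eqP; case.
  rewrite mulmxA mulmxBr -!colE mxE [X in _ + X]mxE !mxE.
  apply/eqP; rewrite subr_eq0; apply/eqP.
  move: xij; rewrite /xi /tight mxE [RHS]mxE ![const_mx _ _ _]mxE => /addIr.
  by rewrite !mxE.
have : (delta_mx i 0 - delta_mx j 0 : 'cV[R]_n.+1) = 0.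
  by rewrite -[LHS]mul1mx -(tree_basis nB) mulmxDl -!mulmxA G0 d0 !mulmx0 addr0.
move=> /matrixP/(_ i 0)/eqP; rewrite !mxE !eqxx (negbTE ij) subr0.
by rewrite oner_eq0.
Qed.

End TreeCone.

(** The cones assigned to [B] subdivide the cone of [B], whose matrix in edge coordinates is the
    identity. [cone_relation] is applied with coefficient -1 for the latter and 1 for the pieces. *)
Lemma tree_cone_sum x B (beta : 'M[R]_(n, n.+1) -> pbtree) :
  (forall V, V \in T -> nnodes (beta V) = n.+1 /\
     forall v, cone_span V v -> ordered 0 (beta V) (fun j => v 0 (inord j))) ->
  nnodes B = n.+1 -> \sum_p x p = 0 -> dmv_regular (@Delta R n) T x 0 ->
  \sum_(V <- T | beta V == B)
    `|\det (col_mx (const_mx 1 : 'rV[R]_n.+1) V : 'M[R]_n.+1)|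
      / \prod_(k < n) dmv_form (@Delta R n) x 0 (row k V) =
  (\prod_(k < n) dmv_form (@Delta R n) x 0 (row k (branch_mx R n B)))^-1.
Proof.
move=> betaP nB x0 reg.
set E := edge_mx R n B; set G := branch_mx R n B.
have [f [f1 fP]] := @dmv_form_linear R n x B nB.
rewrite x0 oppr0 raddf0 in f1.
have betaB V : V \in T -> beta V = B ->
    forall v, cone_span V v -> ordered 0 B (fun j => v 0 (inord j)).
  by move=> /betaP[_ + <-].
have VEGf V : V *m E *m (G *m f) = V *m f.
  rewrite -[in RHS](mulmx1 V) -(tree_basis nB) mulmxDr mulmxDl -!mulmxA f1.
  by rewrite !mulmx0 add0r.
have formV V k : V \in T -> beta V = B ->
    (V *m E *m (G *m f)) k 0 = dmv_form (@Delta R n) x 0 (row k V).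
  move=> VT VB; rewrite fP; first by rewrite VEGf -row_mul [RHS]mxE.
  exact: (betaB V VT VB) (cone_span_row V k).
have formG k : (G *m f) k 0 = dmv_form (@Delta R n) x 0 (row k G).
  by rewrite fP; [rewrite -row_mul [RHS]mxE|apply: branch_ordered].
pose tT (i : 'I_(size T)) := tnth (in_tuple T) i.
have tTT i : tT i \in T by exact: mem_tnth.
pose P (s : unit + 'I_(size T)) :=
  if s is inr i then beta (tT i) == B else true.
pose M (s : unit + 'I_(size T)) := if s is inr i then tT i *m E else 1%:M.
pose c (s : unit + 'I_(size T)) : R := if s is inr i then 1 else -1.
(* Two kinds of hyperplanes to avoid: those of the facets of the pieces, and those where two
   coordinates of [xi] agree. *)
pose Hs := [seq h <- [seq col k (invmx (V *m E)) | V <- T, k <- enum 'I_n] ++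
  [seq G *m (delta_mx i 0 - delta_mx j 0) |
    i <- enum 'I_n.+1, j <- enum 'I_n.+1] | h != 0].
have VU V : V \in T -> beta V = B -> V *m E \in unitmx.
  by move=> VT VB; apply: (cone_proj_unit VT nB); apply: betaB.
have := @cone_relation R n _ P M c (G *m f) Hs.
have -> : \sum_(i | P i) c i * (`|\det (M i)| / \prod_k (M i *m (G *m f)) k 0) =
   - (\prod_(k < n) dmv_form (@Delta R n) x 0 (row k G))^-1 +
   \sum_(V <- T | beta V == B)
    `|\det (col_mx (const_mx 1 : 'rV[R]_n.+1) V : 'M[R]_n.+1)|
      / \prod_(k < n) dmv_form (@Delta R n) x 0 (row k V).
  rewrite big_sumType /=; congr (_ + _).
    rewrite (big_pred1 tt) => [|[]] //=.
    rewrite det1 normr1 mul1r mulN1r mul1mx; congr (- _^-1).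
    by apply: eq_bigr => k _.
  rewrite [RHS](big_nth 0) big_mkord; apply: eq_big => [i|i /eqP iB].
    by rewrite /tT (tnth_nth 0).
  rewrite mul1r norm_det_proj // /tT (tnth_nth 0) /=; congr (_ / _).
  apply: eq_bigr => k _; rewrite formV ?mem_nth //.
  by move: iB; rewrite /tT (tnth_nth 0).
move=> main; apply/eqP; rewrite -subr_eq0 addrC; apply/eqP; apply: main.
- by case=> [_|i /eqP iB] /=; [rewrite unitmx1|apply: VU].
- case=> [_ k _|i k /eqP iB] /=.
    by rewrite mul1mx formG; apply: dmv_form_branch_neq0.
  by rewrite formV //; apply: reg.
- by move=> h; rewrite mem_filter => /andP[].
move=> y geny; set xi := tight (y *m G).
have genV V k : V \in T -> beta V = B -> (y *m col k (invmx (V *m E))) 0 0 != 0.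
  move=> VT VB; apply: geny; rewrite mem_filter mem_cat; apply/andP; split.
    apply/eqP => /(congr1 (mulmx (V *m E))).
    rewrite mulmx0 colE mulmxA mulmxV ?VU // mul1mx => /matrixP/(_ k 0)/eqP.
    by rewrite !mxE !eqxx oner_eq0.
  by apply/orP; left; apply: allpairs_f => //; rewrite mem_enum.
have inV V : V \in T -> beta V = B -> in_cone (V *m E) y <-> cone_span V xi.
  by move=> VT VB; apply: in_cone_span => //; apply: betaB.
(* The common face contains the generic point [xi], so it is all of both cones. *)
have uniqV V W : V \in T -> W \in T -> beta V = B -> beta W = B ->
    cone_span V xi -> cone_span W xi -> V = W.
  move=> VT WT VB WB Vxi Wxi.
  case: hT => _ [_ inj] _ /(_ V W VT WT) [S [S' [HS HS']]].
  have SV : S = [set: 'I_n]%SET.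
    apply: (@cone_face_full B y nB V); [exact: VU|by move=> k; apply: genV|].
    by rewrite -HS.
  have SW : S' = [set: 'I_n]%SET.
    apply: (@cone_face_full B y nB W); [exact: VU|by move=> k; apply: genV|].
    by rewrite -HS'.
  by apply: inj => //; rewrite /cone_span -{1}SV -HS HS' SW.
rewrite big_sumType /= (big_pred1 tt) => [|[]] //=; rewrite mulN1r.
under eq_bigr do rewrite mul1r.
have [y1|y1] := boolP (in_cone 1%:M y).
  have oxi := (in_cone_ordered y nB).1 y1.
  have [V VT Vxi] := cone_cover (total_min_tight (y *m G) : total_min xi = 0).
  have [nbV obV] := betaP V VT.
  (* The coordinates of [xi] are distinct and ordered by both trees, so the trees agree. *)
  have VB : beta V = B.
    apply: (@ordered_inj R (fun j => xi 0 (inord j)) 0);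
      rewrite ?nbV ?nB //; last exact: obV.
    move=> i j; rewrite !add0n => /= ib jb xij.
    rewrite -(@inordK n i) // -(@inordK n j) //; congr (nat_of_ord _).
    apply: (xi_inj nB _ xij) => i1 j1 /= d0; apply: geny.
    rewrite mem_filter d0 mem_cat; apply/orP; right.
    apply: (allpairs_f (fun i j => G *m (delta_mx i 0 - delta_mx j 0)));
      by rewrite mem_enum.
  have /tnthP[i0 Vi0] : V \in in_tuple T by [].
  rewrite (bigD1 i0) /=; last by rewrite /tT -Vi0 VB.
  rewrite (_ : in_cone (tT i0 *m E) y); last by rewrite /tT -Vi0; apply/inV.
  rewrite big1 => [|i /andP[/eqP iB ii0]]; first by rewrite addr0 addNr.
  rewrite (_ : in_cone _ _ = false) //; apply/negbTE/negP.
  move=> /(inV _ (tTT i) iB) ixi.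
  case/eqP: ii0; have [_ [uT _] _ _] := hT; apply/val_inj/eqP.
  rewrite -(nth_uniq 0 _ _ uT) ?ltn_ord //; apply/eqP.
  rewrite -!(tnth_nth 0 (in_tuple T)) -Vi0; exact: uniqV.
rewrite big1 => [|i /eqP iB]; first by rewrite addr0 oppr0.
rewrite (_ : in_cone _ _ = false) //; apply/negbTE; apply: contra y1.
move=> /(inV _ (tTT i) iB) ixi.
by apply/(in_cone_ordered y nB); apply: betaB ixi.
Qed.

(** With weight [N - 1] on the full interval and -1 elsewhere, the form sums the excesses of the
    interval minima over the global minimum. It vanishes only at constant vectors, and no generator
    is constant. *)
Lemma exists_regular :
  exists x, \sum_p x p = 0 /\ dmv_regular (@Delta R n) T x 0.
Proof.
pose p0 : interval_idx n.+1 := exist _ (ord0, ord_max) (leq0n _).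
pose N : R := #|{: interval_idx n.+1}|%:R.
exists (fun p => (p == p0)%:R * N - 1); split.
  rewrite sumrB -mulr_suml (bigD1 p0) //= eqxx big1 => [|p /negbTE -> //].
  by rewrite addr0 mul1r sumr_const subrr.
move=> V VT k; rewrite dmv_formE oppr_eq0.
have -> : \sum_p ((p == p0)%:R * N - 1) * interval_min p (row k V) =
    - \sum_p (interval_min p (row k V) - interval_min p0 (row k V)).
  rewrite [in RHS]sumrB sumr_const opprB -mulr_natl -/N.
  under eq_bigr do rewrite mulrBl mul1r -mulrA.
  rewrite sumrB; congr (_ - _).
  rewrite (bigD1 p0) //= eqxx mul1r big1 ?addr0 // => p /negbTE ->.
  by rewrite mul0r.
rewrite oppr_eq0; apply/eqP => /psumr_eq0P H0.
have d0 p : 0 <= interval_min p (row k V) - interval_min p0 (row k V).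
  rewrite subr_ge0; have [i _ ->] := interval_min_attained p (row k V).
  by apply: interval_min_le; rewrite /= -ltnS ltn_ord.
have {}H0 p : interval_min p (row k V) = interval_min p0 (row k V).
  by apply/eqP; rewrite -subr_eq0; apply/eqP/H0.
have row_const : row k V = 0 + const_mx (interval_min p0 (row k V)).
  apply/matrixP => i j.
  rewrite ord1 [RHS]mxE [X in X + _]mxE [X in _ + X]mxE add0r.
  (* The one-point intervals show that all coordinates are equal. *)
  pose q : interval_idx n.+1 := exist _ (j, j) (leqnn j).
  rewrite -(H0 q) (@interval_minE _ _ q _ j) ?mxE ?leqnn // => l /=.
  by rewrite -eqn_leq => /eqP/val_inj ->; rewrite mxE.
have := cone_total_min VT (cone_span_row V k); rewrite row_const total_minDc.
have -> : total_min (0 : 'rV[R]_n.+1) = 0.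
  rewrite total_minE dmv_formE big1 ?oppr0 // => p _.
  have [i _ ->] := interval_min_attained p (0 : 'rV[R]_n.+1).
  by rewrite mxE mulr0.
rewrite add0r => /eqP.
rewrite mulrn_eq0 eqn0Ngt card_interval_idx_gt0 /= => /eqP m0.
have [free _ _ _] := hT.
have : (delta_mx 0 k : 'rV[R]_n) *m V = 0 *m V.
  rewrite mul0mx -rowE row_const m0.
  by apply/matrixP => i j; rewrite !mxE addr0.
move=> /(row_free_inj (free V VT))/matrixP/(_ 0 k)/eqP.
by rewrite !mxE !eqxx oner_eq0.
Qed.

End Triangulation.

(** The first part says that the denominators of the volume do not all degenerate on the hyperplane,
    so that the identity at regular points is not vacuous. *)
Theorem proposition14p7 (R : realType) (n : nat) (T : seq 'M[R]_(n, n.+1))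
    (hT : is_dmv_triangulation (@Delta R n) T) :
  (exists x : interval_idx n.+1 -> R,
     \sum_p x p = 0 /\ dmv_regular (@Delta R n) T x 0) /\
  (forall x : interval_idx n.+1 -> R,
     \sum_p x p = 0 -> dmv_regular (@Delta R n) T x 0 ->
     hyp_dual_mixed_volume (@Delta R n) T x 0 =
     (-1) ^+ n *
     \sum_(B \in PB n.+1) \prod_(e <- edges B)
       (\sum_(p : interval_idx n.+1 | ((val p).1 \in lower_part n.+1 B e) &&
                                  ((val p).2 \in lower_part n.+1 B e)) x p)^-1).
Proof.
split=> [|x x0 reg]; first exact: exists_regular.
(* One tree is fixed for each cone, which splits the volume into one sum per tree; [Leaf] is a
   default outside [T]. *)
have /choice[beta betaP] V : exists B, V \in T -> nnodes B = n.+1 /\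
    forall v, cone_span V v -> ordered 0 B (fun j => v 0 (inord j)).
  have [VT|VT] := boolP (V \in T); last by exists Leaf.
  by have [B HB] := cone_tree hT VT; exists B.
have memPB (B : pbtree) : (B \in fset_set (PB n.+1)) = (nnodes B == n.+1).
  by rewrite in_fset_set ?inE; [apply/idP/eqP; rewrite inE|exact: finite_PB].
rewrite fsbig_finite; last exact: finite_PB.
rewrite big_distrr /= /hyp_dual_mixed_volume.
transitivity (\sum_(B <- fset_set (PB n.+1)) \sum_(V <- T | beta V == B)
    `|\det (col_mx (const_mx 1 : 'rV[R]_n.+1) V : 'M[R]_n.+1)|
      / \prod_(k < n) dmv_form (@Delta R n) x 0 (row k V)).
  rewrite (exchange_big_dep predT) //= big_seq [RHS]big_seq.
  apply: eq_bigr => V VT.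
  have bV : beta V \in enum_fset (fset_set (PB n.+1)).
    by have := memPB (beta V); rewrite (proj1 (betaP V VT)) eqxx.
  rewrite -[RHS]big_filter (@eq_filter _ _ (pred1 (beta V))) => [|B].
    by rewrite (filter_pred1_uniq (fset_uniq _) bV) big_seq1.
  by rewrite /= eq_sym.
rewrite big_seq [RHS]big_seq; apply: eq_bigr => B; rewrite memPB => /eqP nB.
by rewrite (tree_cone_sum hT betaP nB x0 reg) (prod_dmv_form_branch nB).
Qed.
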